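(* There exists an algorithm which, for any signed graph $G_\phi$ (with connected underlying graph $G$ and chosen sink $q$), constructs the set of all $z$-superstable configurations of $G_\phi$ and the set of all critical configurations of $G_\phi$.
   Context: A signed graph $G_\phi$ is a finite simple graph $G=(V,E)$ with a sign function $\phi:E\to\{+,-\}$. A vertex $q$ is chosen as sink and $v_1,\dots,v_n$ are the other (nonsink) vertices. The reduced signed Laplacian $L=L_{G_\phi}$ is the $n\times n$ matrix with $L_{ii}=\deg_G(v_i)$ (counting edges to $q$) and, for $i\neq j$, $L_{ij}=-1$ if $v_iv_j$ is a positive edge, $+1$ if it is a negative edge, $0$ if it is not an edge. $M=L_G$ is the same matrix for the all-positive signing. With $G$ connected, both are invertible and $M^{-1}$ has nonnegative entries. The valid configurations are $S^+=\{\vec{c}\in\mathbb{Z}^n: ML^{-1}\vec{c}\ge\vec{0}\}$. For $\vec{c}\in S^+$: site $i$ is ready to fire if $\vec{c}-L\vec{e}_i\in S^+$; $\vec{c}$ is stable if no site is ready to fire; $\vec{c}$ is $z$-superstable if $\vec{c}-L\vec{z}\notin S^+$ for all nonzero $\vec{z}\in\mathbb{Z}^n_{\ge0}$; $\vec{c}$ is reachable if there is $\vec{d}\in S^+$ with $\vec{d}-L\vec{e}_i\in S^+$ for all $i$ and a finite sequence $i_1,\dots,i_k$ with $\vec{c}=\vec{d}-\sum_{j=1}^kL\vec{e}_{i_j}$ and all $\vec{d}-\sum_{j=1}^{\ell}L\vec{e}_{i_j}$, $\ell\le k$, in $S^+$; $\vec{c}$ is critical if it is stable and reachable. ''Algorithm''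 means a terminating computable procedure whose input is the finite data $(G,\phi,q)$ and whose output is the two (finite) sets listed. *)

(* Defs.v *)
From HB Require Import structures.
From mathcomp Require Import all_boot all_order all_algebra.
Set Implicit Arguments.
Unset Strict Implicit.
Unset Printing Implicit Defensive.
Import Order.TTheory GRing.Theory Num.Theory.
Local Open Scope ring_scope.

(* The vertex set is 'I_n.+1; [positive] is only meaningful on edges. *)
Record signed_graph (n : nat) := SignedGraph {
  edge : rel 'I_n.+1;
  positive : rel 'I_n.+1;
  edge_sym : symmetric edge;
  edge_irr : irreflexive edge;
  positive_sym : forall u v, edge u v -> positive u v = positive v u
}.

Definition connected_graph n (G : signed_graph n) : Prop :=
  forall u v, connect (edge G) u v.

Definition degree n (G : signed_graph n) (u : 'I_n.+1) : nat :=
  #|[set v | edge G u v]|.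

Definition all_positive n (G : signed_graph n) : signed_graph n :=
  @SignedGraph n (edge G) (fun _ _ => true) (@edge_sym n G) (@edge_irr n G)
    (fun _ _ _ => erefl).

(* The nonsink vertices are enumerated, in increasing order, by [lift q]. *)
Definition reduced_laplacian n (G : signed_graph n) (q : 'I_n.+1) : 'M[int]_n :=
  \matrix_(i < n, j < n)
    (if i == j then (degree G (lift q i))%:Z
     else if edge G (lift q i) (lift q j) then
       (if positive G (lift q i) (lift q j) then -1 else 1)
     else 0).

Section Configurations.
Variables (n : nat) (G : signed_graph n) (q : 'I_n.+1).
Implicit Types c d z : 'cV[int]_n.

Local Notation L := (reduced_laplacian G q).
Local Notation M := (reduced_laplacian (all_positive G) q).

(* c \in S^+ ; L is inverted over the rationals. *)
Definition valid c : Prop :=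
  forall i, 0 <= (map_mx (intr : int -> rat) M
                  *m invmx (map_mx (intr : int -> rat) L)
                  *m map_mx (intr : int -> rat) c) i 0.

Definition fire c (i : 'I_n) : 'cV[int]_n := c - L *m delta_mx i 0.

Definition ready c (i : 'I_n) : Prop := valid (fire c i).

Definition stable c : Prop := valid c /\ forall i, ~ ready c i.

Definition z_superstable c : Prop :=
  valid c /\
  forall z, z != 0 -> (forall i, 0 <= z i 0) -> ~ valid (c - L *m z).

Definition reachable c : Prop :=
  valid c /\
  exists d, [/\ valid d, forall i, ready d i
    & exists s : seq 'I_n, c = foldl fire d s /\
        forall l, (l <= size s)%N -> valid (foldl fire d (take l s))].

Definition critical c : Prop := stable c /\ reachable c.

End Configurations.

(* Kleene's partial recursive (mu-recursive) functions. Programs carry no      *)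
(* arity: they are run on a finite list of arguments, and a missing argument   *)
(* of Succ or Proj reads as 0.                                                 *)
Inductive program : Type :=
| Zero
| Succ
| Proj of nat
| Comp of program & seq program
| PrimRec of program & program
| Mu of program.

(* [runs p xs v]: p halts on the arguments xs with result v. In runs_Mu, only   *)
(* the values of w below k matter: f halts there with nonzero results.         *)
Inductive runs : program -> seq nat -> nat -> Prop :=
| runs_Zero xs : runs Zero xs 0%N
| runs_Succ xs : runs Succ xs (nth 0%N xs 0%N).+1
| runs_Proj i xs : runs (Proj i) xs (nth 0%N xs i)
| runs_Comp f gs xs ys v :
    size ys = size gs ->
    (forall i, (i < size gs)%N -> runs (nth Zero gs i) xs (nth 0%N ys i)) ->
    runs f ys v -> runs (Comp f gs) xs v
| runs_PrimRec0 f g xs v :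
    runs f xs v -> runs (PrimRec f g) (0%N :: xs) v
| runs_PrimRecS f g k xs u v :
    runs (PrimRec f g) (k :: xs) u -> runs g [:: k, u & xs] v ->
    runs (PrimRec f g) (k.+1 :: xs) v
| runs_Mu f xs k (w : nat -> nat) :
    runs f (k :: xs) 0%N ->
    (forall m, (m < k)%N -> runs f (m :: xs) (w m).+1) ->
    runs (Mu f) xs k.

Lemma runs_functional p xs v1 v2 : runs p xs v1 -> runs p xs v2 -> v1 = v2.
Proof.
move=> H; elim: H v2 => {p xs v1}.
- by move=> xs v2 H; inversion H.
- by move=> xs v2 H; inversion H.
- by move=> i xs v2 H; inversion H.
- move=> f gs xs ys v sz _ IHg _ IHf v2 H; inversion H; subst.
  apply: IHf; suff -> : ys = ys0 by [].
  apply: (@eq_from_nth _ 0%N) => [|i]; first by rewrite sz.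
  by rewrite sz => lti; apply: IHg => //; auto.
- by move=> f g xs v _ IH v2 H; inversion H; subst; apply: IH.
- move=> f g k xs u v _ IHu _ IHv v2 H; inversion H; subst.
  by apply: IHv; match goal with R : runs (PrimRec f g) _ _ |- _ => rewrite (IHu _ R) end.
- move=> f xs k w _ IH0 _ IHw v2 H.
  have [w' [R0 Rw]] : exists w', runs f (v2 :: xs) 0%N /\
      forall m, (m < v2)%N -> runs f (m :: xs) (w' m).+1.
    by inversion H; subst; eexists; split; eassumption.
  case: (ltngtP k v2) => // lt; first by have := IH0 _ (Rw _ lt).
  by have := IHw _ lt _ R0.
Qed.

(* [CodeSeq.code : seq nat -> nat] is the bijection sending nil to 0 and       *)
(* n :: s to 2 ^ n * (2 * code s + 1).                                         *)
Definition encode_int (z : int) : nat :=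
  match z with Posz m => m.*2 | Negz m => m.*2.+1 end.

Definition encode_config n (c : 'cV[int]_n) : nat :=
  CodeSeq.code [seq encode_int (c i 0) | i <- enum 'I_n].

Definition encode_configs n (s : seq 'cV[int]_n) : nat :=
  CodeSeq.code [seq encode_config c | c <- s].

Definition encode_output n (s t : seq 'cV[int]_n) : nat :=
  CodeSeq.code [:: encode_configs s; encode_configs t].

Definition edge_label n (G : signed_graph n) (u v : 'I_n.+1) : nat :=
  if edge G u v then (if positive G u v then 1%N else 2%N) else 0%N.

Definition encode_input n (G : signed_graph n) (q : 'I_n.+1) : seq nat :=
  [:: n; nat_of_ord q;
      CodeSeq.code [seq edge_label G u v | u <- enum 'I_n.+1, v <- enum 'I_n.+1]].

Definition lists_exactly n (s : seq 'cV[int]_n) (P : 'cV[int]_n -> Prop) : Prop :=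
  uniq s /\ forall c, c \in s <-> P c.

(* Main.v *)
Require Import Defs.
From mathcomp Require Import all_boot all_order all_fingroup all_algebra zify lra.

Set Implicit Arguments.
Unset Strict Implicit.
Unset Printing Implicit Defensive.

(** The change of variables [c = L y], [x = M y] turns firing in the signed graph
    into chip-firing on the underlying graph. A configuration [c] is valid
    exactly when the rational vector [x = M L^-1 c] is nonnegative, and firing
    site [i] subtracts [M e_i] from [x]. Since the off-diagonal entries of [M]
    are nonpositive, site [i] is ready exactly when [x_i] is at least its degree.
    Write [d_T(i)] for the number of neighbours of [i] in a set [T] of sites.
    The classical arguments then apply to [x], integral or not:

    - [c] is z-superstable iff it is valid and every nonempty [T] has a site [i]
      with [x_i < deg i - d_T(i)] (z_superstable_iff). If [z] can be fired, so
      can the set of sites where [z] is maximal.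
    - [c] is critical iff it is valid, [x_i < deg i] for all [i], and every
      nonempty [T] has a site [i] with [x_i >= d_T(i)] (critical_iff). For the
      direct implication, look at the site of [T] whose last firing comes first.
      Conversely, start from [c + L z] with [M z] larger than the degrees, and
      always fire a site where the remaining [z] is maximal.

    In both cases [0 <= x_i < deg i]. Connectivity gives a minimum principle for
    [M] (minimum_principle): [M u >= 0] implies [u >= 0]. It follows that [L] and
    [M] are invertible, that [y = M^-1 x] is nonnegative, and that [y] is bounded
    by determinants. Let [N] bound the determinants of the integer matrices at
    hand; the factorial [D] of [N] is a multiple of the determinant of [L], so
    [D y] is a vector of natural numbers with an explicit bound, and so is [c] up
    to signs (solution_exists, solution_bounds, stable_bounds).

    Hence a configuration [c] has either property iff some bounded vector [Y] of
    natural numbers satisfies [L Y = D c] together with inequalities between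
    natural numbers, quantified over the subsets of the sites. The program lists
    the codes [e] below a computed bound that pass this test. That it can be
    written as a mu-recursive program follows from closure properties of the
    computable functions: primitive recursion gives bounded sums, these give
    arithmetic and bounded quantifiers, and the coding of sequences is accessible
    through bounded sums as well (sum_decode_cons). *)

(** * Computable functions *)

(** The length of the argument list is fixed: a program that calls a recursion
    must copy its own arguments one projection at a time, so it has to know how
    many there are. *)
Definition computable k (f : seq nat -> nat) : Prop :=
  exists p, forall xs, size xs = k -> runs p xs (f xs).

Definition decidable_pred k (P : seq nat -> bool) : Prop :=
  computable k (fun xs => P xs : nat).

Lemma eq_computable k f g :
    (forall xs, size xs = k -> f xs = g xs) ->
  computable k f -> computable k g.
Proof. by move=> fg [p pP]; exists p => xs sz; rewrite -fg //; apply: pP. Qed.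

Lemma computable_ext k f g : f =1 g -> computable k f -> computable k g.
Proof. by move=> fg; apply: eq_computable => xs _. Qed.

Lemma computable_proj k i : computable k (fun xs => nth 0 xs i).
Proof. by exists (Proj i) => xs _; constructor. Qed.

Lemma programs_of k (gs : seq (seq nat -> nat)) :
    (forall i, i < size gs -> computable k (nth (fun=> 0) gs i)) ->
  exists ps, size ps = size gs /\ forall xs, size xs = k ->
    forall i, i < size ps -> runs (nth Zero ps i) xs (nth 0 [seq g xs | g <- gs] i).
Proof.
elim: gs => [|g gs IH] gsP; first by exists [::].
have [p pP] := gsP 0 isT.
have [|ps [sz psP]] := IH; first by move=> i lt_i; apply: (gsP i.+1).
exists (p :: ps); split=> [|xs szx [|i] lt_i] /=; first by rewrite sz.
  exact: pP.
exact: psP.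
Qed.

Lemma computable_comp k f (gs : seq (seq nat -> nat)) :
    computable (size gs) f ->
    (forall i, i < size gs -> computable k (nth (fun=> 0) gs i)) ->
  computable k (fun xs => f [seq g xs | g <- gs]).
Proof.
move=> [p pP] /programs_of[ps [sz psP]].
exists (Comp p ps) => xs szx.
apply: (runs_Comp (ys := [seq g xs | g <- gs])); first by rewrite size_map.
  exact: psP.
by apply: pP; rewrite size_map.
Qed.

(** Projections rearrange the argument list at will; moving a function to a
    context with more arguments is the case of interest. *)
Lemma computable_select k f (js : seq nat) :
  computable (size js) f -> computable k (fun xs => f [seq nth 0 xs j | j <- js]).
Proof.
move=> fP; pose gs := [seq (fun xs => nth 0 xs j) | j <- js].
apply: (@computable_ext k (fun xs => f [seq g xs | g <- gs])).
  by move=> xs; rewrite -map_comp.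
apply: computable_comp; rewrite size_map // => i lt_i.
by rewrite (nth_map 0) //; apply: computable_proj.
Qed.

Lemma nth_args (xs ys : seq nat) j :
  drop j ys = xs -> [seq nth 0 ys i | i <- iota j (size xs)] = xs.
Proof.
move=> <-; have -> : size (drop j ys) = size ys - j by rewrite size_drop.
apply: (@eq_from_nth _ 0) => [|i]; rewrite size_map size_iota ?size_drop // => lt_i.
by rewrite (nth_map 0) ?size_iota // nth_iota // nth_drop.
Qed.

Lemma computable_weaken k f :
  computable k f -> computable k.+1 (fun xs => f (behead xs)).
Proof.
move=> fP; apply: (@eq_computable _ (fun xs => f [seq nth 0 xs j | j <- iota 1 k])).
  by case=> // x xs [<-] /=; rewrite nth_args //= ?drop0.
by apply: computable_select; rewrite size_iota.
Qed.

Lemma computable_skip k f :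
  computable k.+1 f -> computable k.+2 (fun xs => f (nth 0 xs 0 :: behead (behead xs))).
Proof.
move=> fP; apply: (@eq_computable _ (fun xs => f [seq nth 0 xs j | j <- 0 :: iota 2 k])).
  by case=> [|x [|y xs]] // [<-]; rewrite map_cons nth_args //= ?drop0.
by apply: computable_select; rewrite /= size_iota.
Qed.

Lemma computable_weaken2 k f :
  computable k f -> computable k.+2 (fun xs => f (behead (behead xs))).
Proof.
move=> fP; apply: (@computable_weaken _ (fun xs => f (behead xs))).
exact: computable_weaken.
Qed.

Lemma computable_weaken3 k f :
  computable k f -> computable k.+3 (fun xs => f (behead (behead (behead xs)))).
Proof.
move=> fP; apply: (@computable_weaken _ (fun xs => f (behead (behead xs)))).
exact: computable_weaken2.
Qed.

Lemma computable_succ k f : computable k f -> computable k (fun xs => (f xs).+1).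
Proof.
move=> fP; apply: (@computable_comp k (fun xs => (nth 0 xs 0).+1) [:: f]).
  by exists Succ => xs _; constructor.
by case.
Qed.

Lemma computable_const k m : computable k (fun=> m).
Proof.
elim: m => [|m IH]; last exact: computable_succ.
by exists Zero => xs _; constructor.
Qed.

(** In this lemma and in the ones below that bind a variable, the body is
    computed with the bound values in front of the ambient arguments [xs]. This
    shape lets unification read the body off a goal, so that each later
    definition is seen to be computable from the way it is written. *)
Lemma computable_iteri k b a (g : nat -> nat -> seq nat -> nat) :
    computable k b -> computable k a ->
    computable k.+2 (fun xs => g (nth 0 xs 0) (nth 0 xs 1) (behead (behead xs))) ->
  computable k (fun xs => iteri (b xs) (fun i u => g i u xs) (a xs)).
Proof.
move=> bP [pa paP] [pg pgP].
pose rec xs := iteri (nth 0 xs 0) (fun i u => g i u (behead xs)) (a (behead xs)).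
have recP : computable k.+1 rec.
  exists (PrimRec pa pg) => -[|m xs] // [szx]; rewrite /rec /=.
  elim: m => [|m IH]; first exact/runs_PrimRec0/paP.
  apply: runs_PrimRecS IH _; apply: (pgP [:: m, _ & xs]).
  by rewrite /= szx.
pose gs := b :: [seq (fun xs => nth 0 xs i) | i <- iota 0 k].
apply: (@eq_computable k (fun xs => rec [seq g xs | g <- gs])).
  by move=> xs szx; rewrite /gs /= -map_comp -szx nth_args ?drop0.
apply: computable_comp => [|[|i]]; rewrite /= size_map size_iota // ltnS => lt_ik.
by rewrite (nth_map 0) ?size_iota //; apply: computable_proj.
Qed.

(** A conditional is a recursion of length 0 or 1. *)
Lemma computable_if k (P : seq nat -> bool) f g :
    decidable_pred k P -> computable k f -> computable k g ->
  computable k (fun xs => if P xs then f xs else g xs).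
Proof.
move=> PP fP gP.
pose h xs := iteri (P xs : nat) (fun _ _ => f xs) (g xs).
apply: (@computable_ext k h); first by move=> xs; rewrite /h; case: (P xs).
apply: (computable_iteri (g := fun _ _ => f)) => //.
exact: computable_weaken2.
Qed.

Lemma computable_add k f g :
  computable k f -> computable k g -> computable k (fun xs => f xs + g xs).
Proof.
move=> fP gP.
pose h xs := iteri (f xs) (fun _ u => u.+1) (g xs).
apply: (@computable_ext k h); first by move=> xs; rewrite /h; elim: (f xs) => //= m ->.
apply: (computable_iteri (g := fun _ u _ => u.+1)) => //.
exact/computable_succ/computable_proj.
Qed.

(** The accumulator of the recursion sits between the index and the ambient
    arguments, and the summand has to skip it. *)
Lemma computable_sum k b (F : nat -> seq nat -> nat) :
    computable k b ->
    computable k.+1 (fun xs => F (nth 0 xs 0) (behead xs)) ->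
  computable k (fun xs => \sum_(0 <= i < b xs) F i xs).
Proof.
move=> bP FP.
pose h xs := iteri (b xs) (fun i u => F i xs + u) 0.
apply: (@computable_ext k h).
  move=> xs; rewrite /h; elim: (b xs) => [|m IH] /=; first by rewrite big_geq.
  by rewrite big_nat_recr //= IH addnC.
apply: (computable_iteri (g := fun i u xs => F i xs + u)) => //; first exact: computable_const.
apply: computable_add; last exact: computable_proj.
exact: (computable_skip FP).
Qed.

Lemma computable_mul k f g :
  computable k f -> computable k g -> computable k (fun xs => f xs * g xs).
Proof.
move=> fP gP; apply: (@computable_ext k (fun xs => \sum_(0 <= i < f xs) g xs)).
  by move=> xs; rewrite sum_nat_const_nat subn0.
by apply: computable_sum => //; apply: computable_weaken.
Qed.

Lemma computable_double k f : computable k f -> computable k (fun xs => (f xs).*2).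
Proof.
move=> fP; apply: (@computable_ext k (fun xs => f xs + f xs)).
  by move=> xs; rewrite addnn.
exact: computable_add.
Qed.

Lemma computable_expn k f g :
  computable k f -> computable k g -> computable k (fun xs => f xs ^ g xs).
Proof.
move=> fP gP; apply: (@computable_ext k (fun xs => iteri (g xs) (fun _ u => f xs * u) 1)).
  by move=> xs; elim: (g xs) => [|m IH] //=; rewrite expnS IH.
apply: (computable_iteri (g := fun _ u xs => f xs * u)) => //; first exact: computable_const.
apply: computable_mul; last exact: computable_proj.
exact: computable_weaken2.
Qed.

Lemma computable_factorial k f : computable k f -> computable k (fun xs => (f xs)`!).
Proof.
move=> fP; apply: (@computable_ext k (fun xs => iteri (f xs) (fun i u => i.+1 * u) 1)).
  by move=> xs; elim: (f xs) => [|m IH] //=; rewrite factS IH.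
apply: (computable_iteri (g := fun i u _ => i.+1 * u)) => //; first exact: computable_const.
apply: computable_mul; last exact: computable_proj.
exact/computable_succ/computable_proj.
Qed.

Lemma decidable_neg k P : decidable_pred k P -> decidable_pred k (fun xs => ~~ P xs).
Proof.
move=> PP; apply: (@computable_ext k (fun xs => if P xs then 0 else 1)).
  by move=> xs; case: (P xs).
by apply: computable_if => //; apply: computable_const.
Qed.

Lemma decidable_and k P Q :
  decidable_pred k P -> decidable_pred k Q -> decidable_pred k (fun xs => P xs && Q xs).
Proof.
move=> PP QP; apply: (@computable_ext k (fun xs => (P xs : nat) * (Q xs : nat))).
  by move=> xs; rewrite mulnb.
exact: computable_mul.
Qed.

Lemma decidable_implies k P Q :
  decidable_pred k P -> decidable_pred k Q -> decidable_pred k (fun xs => P xs ==> Q xs).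
Proof.
move=> PP QP; apply: (@computable_ext k (fun xs => ~~ (P xs && ~~ Q xs) : nat)).
  by move=> xs; case: (P xs); case: (Q xs).
by apply/decidable_neg/decidable_and => //; apply: decidable_neg.
Qed.

Lemma computable_sub k f g :
  computable k f -> computable k g -> computable k (fun xs => f xs - g xs).
Proof.
have pred_comp j h : computable j h -> computable j (fun xs => (h xs).-1).
  move=> hP; apply: (@computable_ext j (fun xs => iteri (h xs) (fun i _ => i) 0)).
    by move=> xs; case: (h xs).
  apply: (computable_iteri (g := fun i _ _ => i)) => //; first exact: computable_const.
  exact: computable_proj.
move=> fP gP; apply: (@computable_ext k (fun xs => iteri (g xs) (fun _ u => u.-1) (f xs))).
  by move=> xs; elim: (g xs) => [|m IH] /=; rewrite ?subn0 // subnS IH.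
apply: (computable_iteri (g := fun _ u _ => u.-1)) => //.
exact/pred_comp/computable_proj.
Qed.

Lemma decidable_leq k f g :
  computable k f -> computable k g -> decidable_pred k (fun xs => f xs <= g xs).
Proof.
move=> fP gP.
apply: (@computable_ext k (fun xs => iteri (f xs - g xs) (fun _ _ => 0) 1)).
  by move=> xs; rewrite /leq; case: (f xs - g xs).
apply: (computable_iteri (g := fun _ _ _ => 0)); rewrite ?/decidable_pred.
- exact: computable_sub.
- exact: computable_const.
- exact: computable_const.
Qed.

Lemma decidable_ltn k f g :
  computable k f -> computable k g -> decidable_pred k (fun xs => f xs < g xs).
Proof. by move=> fP gP; apply: decidable_leq => //; apply: computable_succ. Qed.

Lemma decidable_eq k f g :
  computable k f -> computable k g -> decidable_pred k (fun xs => f xs == g xs).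
Proof.
move=> fP gP; apply: (@computable_ext k (fun xs => (f xs <= g xs) && (g xs <= f xs) : nat)).
  by move=> xs; rewrite eqn_leq.
by apply: decidable_and; apply: decidable_leq.
Qed.

Lemma decidable_has k b (P : nat -> seq nat -> bool) :
    computable k b ->
    decidable_pred k.+1 (fun xs => P (nth 0 xs 0) (behead xs)) ->
  decidable_pred k (fun xs => has (fun i => P i xs) (iota 0 (b xs))).
Proof.
move=> bP PP.
apply: (@computable_ext k (fun xs => 0 < \sum_(0 <= i < b xs) (P i xs : nat) : nat)).
  move=> xs; rewrite lt0n sum_nat_seq_neq0 /index_iota subn0.
  by congr nat_of_bool; apply: eq_has => i /=; rewrite eqb0 negbK.
apply: decidable_ltn; first exact: computable_const.
exact: (computable_sum (F := fun i xs => P i xs : nat)).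
Qed.

Lemma decidable_all k b (P : nat -> seq nat -> bool) :
    computable k b ->
    decidable_pred k.+1 (fun xs => P (nth 0 xs 0) (behead xs)) ->
  decidable_pred k (fun xs => all (fun i => P i xs) (iota 0 (b xs))).
Proof.
move=> bP PP.
apply: (@computable_ext k (fun xs => ~~ has (fun i => ~~ P i xs) (iota 0 (b xs)) : nat)).
  by move=> xs; rewrite has_predC negbK.
apply/decidable_neg/(decidable_has (P := fun i xs => ~~ P i xs)) => //.
exact: decidable_neg.
Qed.

(** * Coded sequences *)

Local Notation code := CodeSeq.code.
Local Notation decode := CodeSeq.decode.

Lemma leq_code_cons h w : w < code (h :: decode w) /\ h < code (h :: decode w).
Proof.
rewrite /= CodeSeq.decodeK.
have := expn_gt0 2 h; have := ltn_expl h (isT : 1 < 2); nia.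
Qed.

(** A positive [w] is [2 ^ h * (2 * t + 1)] for exactly one pair, whose
    components are the head and the code of the tail of the sequence coded by
    [w]; both are smaller than [w]. A double sum therefore picks that pair out
    without any division. *)
Lemma sum_decode_cons w (F : nat -> nat -> nat) :
  \sum_(0 <= h < w) \sum_(0 <= t < w) F h t * (w == 2 ^ h * t.*2.+1)
  = if decode w is h :: t then F h (code t) else 0.
Proof.
have E h t : (w == 2 ^ h * t.*2.+1) = (decode w == h :: decode t).
  rewrite -(inj_eq (can_inj CodeSeq.decodeK)); congr (_ == _).
  by rewrite -[in RHS](CodeSeq.codeK (h :: _)) /= CodeSeq.decodeK.
under eq_bigr => h _ do under eq_bigr => t _ do rewrite E.
case Dw: (decode w) => [|h t].
  by rewrite big1 // => h _; rewrite big1 // => t _; rewrite muln0.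
have [lt_t lt_h] := leq_code_cons h (code t).
rewrite CodeSeq.codeK -Dw CodeSeq.decodeK in lt_t lt_h.
rewrite (bigD1_seq h) ?iota_uniq ?mem_index_iota //=.
rewrite (bigD1_seq (code t)) ?iota_uniq ?mem_index_iota //=.
rewrite CodeSeq.codeK eqxx muln1.
rewrite [X in _ + X]big1 => [|h' ne_h]; last first.
  by rewrite big1 // => t' _; rewrite eqseq_cons eq_sym (negPf ne_h) muln0.
rewrite [X in _ + X + _]big1 ?addn0 // => t' ne_t.
rewrite -(inj_eq (can_inj CodeSeq.decodeK)) CodeSeq.codeK in ne_t.
by rewrite eqseq_cons eqxx eq_sym (negPf ne_t) muln0.
Qed.

Lemma computable_code_cons k h w :
    computable k h -> computable k w ->
  computable k (fun xs => code (h xs :: decode (w xs))).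
Proof.
move=> hP wP; apply: (@computable_ext k (fun xs => 2 ^ h xs * (w xs).*2.+1)).
  by move=> xs; rewrite /= CodeSeq.decodeK.
apply: computable_mul; last exact/computable_succ/computable_double.
by apply: computable_expn => //; apply: computable_const.
Qed.

Lemma computable_decode_cons k w (F : nat -> nat -> nat) :
    computable k w ->
    computable k.+2 (fun xs => F (nth 0 xs 1) (nth 0 xs 0)) ->
  computable k (fun xs => if decode (w xs) is h :: t then F h (code t) else 0).
Proof.
move=> wP FP.
apply: computable_ext (fun xs => sum_decode_cons (w xs) F) _.
apply: (computable_sum (F := fun h xs =>
   \sum_(0 <= t < w xs) F h t * (w xs == 2 ^ h * t.*2.+1))) => //.
apply: (computable_sum (F := fun t xs =>
   F (nth 0 xs 0) t * (w (behead xs) == 2 ^ nth 0 xs 0 * t.*2.+1))).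
  exact: computable_weaken.
apply: computable_mul.
  by apply: computable_ext FP => -[|x []].
apply: decidable_eq; first exact: computable_weaken2.
apply: computable_mul; last exact/computable_succ/computable_double/computable_proj.
apply: computable_expn; first exact: computable_const.
by apply: (@computable_weaken _ (fun xs => nth 0 xs 0)); apply: computable_proj.
Qed.

Lemma computable_drop k w i :
    computable k w -> computable k i ->
  computable k (fun xs => code (drop (i xs) (decode (w xs)))).
Proof.
move=> wP iP.
apply: (@computable_ext k (fun xs =>
  iteri (i xs) (fun _ u => if decode u is _ :: t then code t else 0) (w xs))).
  move=> xs; elim: (i xs) => [|m IH] /=; first by rewrite drop0 CodeSeq.decodeK.
  rewrite IH CodeSeq.codeK -addn1 addnC -drop_drop.
  by case: (drop m _) => //= x s; rewrite drop0.
apply: (computable_iteri (g := fun _ u _ => if decode u is _ :: t then code t else 0)) => //.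
apply: (@computable_decode_cons _ (fun xs => nth 0 xs 1) (fun _ t => t)).
  exact: computable_proj.
exact: computable_proj.
Qed.

Lemma computable_nth k w i :
    computable k w -> computable k i ->
  computable k (fun xs => nth 0 (decode (w xs)) (i xs)).
Proof.
move=> wP iP.
apply: (@computable_ext k (fun xs =>
  if decode (code (drop (i xs) (decode (w xs)))) is h :: _ then h else 0)).
  move=> xs; rewrite CodeSeq.codeK -[in RHS](addn0 (i xs)) -nth_drop.
  by case: (drop _ _).
apply: (@computable_decode_cons _ _ (fun h _ => h)).
  exact: computable_drop.
exact: computable_proj.
Qed.

Lemma decidable_size k w n :
    computable k w -> computable k n ->
  decidable_pred k (fun xs => size (decode (w xs)) == n xs).
Proof.
move=> wP nP.
have code_eq0 s : (code s == 0) = (s == [::]).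
  by rewrite (inj_eq (can_inj CodeSeq.codeK) s [::]).
apply: (@computable_ext k (fun xs => (code (drop (n xs) (decode (w xs))) == 0) &&
    all (fun i => ~~ (code (drop i (decode (w xs))) == 0)) (iota 0 (n xs)) : nat)).
  move=> xs; congr nat_of_bool; rewrite code_eq0 eqn_leq.
  rewrite -size_eq0 size_drop subn_eq0; congr (_ && _).
  apply/allP/idP => [allP|le_n i].
    case: (n xs) allP => // m /(_ m); rewrite mem_iota /= add0n leqnn => /(_ isT).
    by rewrite code_eq0 -size_eq0 size_drop subn_eq0 ltnNge.
  rewrite mem_iota add0n /= => lt_i.
  by rewrite code_eq0 -size_eq0 size_drop subn_eq0 -ltnNge (leq_trans lt_i).
apply: decidable_and.
  by apply: decidable_eq; [apply: computable_drop | apply: computable_const].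
apply: (decidable_all (P := fun i xs => ~~ (code (drop i (decode (w xs))) == 0))) => //.
apply: decidable_neg; apply: decidable_eq; last exact: computable_const.
by apply: computable_drop; [apply: computable_weaken | apply: computable_proj].
Qed.

(** Decreasing order is what a recursion on [K] produces when it conses the next
    element onto the code obtained so far. *)
Definition listing K (P : pred nat) : seq nat := rev [seq e <- iota 0 K | P e].

Lemma mem_listing K P e : (e \in listing K P) = (e < K) && P e.
Proof. by rewrite mem_rev mem_filter mem_iota andbC. Qed.

Lemma uniq_listing K P : uniq (listing K P).
Proof. by rewrite rev_uniq filter_uniq // iota_uniq. Qed.

Lemma computable_listing k K (P : nat -> seq nat -> bool) :
    computable k K ->
    decidable_pred k.+1 (fun xs => P (nth 0 xs 0) (behead xs)) ->
  computable k (fun xs => code (listing (K xs) (fun e => P e xs))).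
Proof.
move=> KP PP.
pose step e u xs := if P e xs then code (e :: decode u) else u.
apply: (@computable_ext k (fun xs => iteri (K xs) (fun e u => step e u xs) 0)).
  move=> xs; elim: (K xs) => [|m IH] //=; rewrite IH /step /listing CodeSeq.codeK.
  rewrite -addn1 iotaD filter_cat rev_cat /= add0n.
  by case: (P m xs).
apply: computable_iteri => //; first exact: computable_const.
apply: computable_if.
- exact: (computable_skip PP).
- by apply: computable_code_cons; apply: computable_proj.
- exact: computable_proj.
Qed.

(** * The reduced Laplacian *)

Section ReducedLaplacian.

Import Order.TTheory GRing.Theory Num.Theory.
Local Open Scope ring_scope.

Variables (n : nat) (G : signed_graph n) (q : 'I_n.+1).

Local Notation L := (reduced_laplacian G q).
Local Notation adj i j := (edge G (lift q i) (lift q j)).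
Local Notation pos i j := (positive G (lift q i) (lift q j)).
Local Notation deg i := (degree G (lift q i)).

Lemma sum_neighbours (R : nmodType) (F : 'I_n.+1 -> R) i :
  \sum_(v | edge G (lift q i) v) F v =
    F q *+ edge G (lift q i) q + \sum_(j | adj i j) F (lift q j).
Proof.
rewrite big_mkcond (bigD1_ord q) //= -big_mkcond /=.
by case: (edge G (lift q i) q).
Qed.

Lemma degreeE i : deg i = (edge G (lift q i) q + \sum_(j < n) adj i j)%N.
Proof.
rewrite /degree -sum1dep_card [LHS](@sum_neighbours nat (fun=> 1%N)); congr addn.
  by case: (edge G _ q).
by rewrite [LHS]big_mkcond; apply: eq_bigr => j _; case: (adj i j).
Qed.

Lemma reduced_laplacianE (R : nzRingType) (u : 'cV[R]_n) i :
  (map_mx intr L *m u) i 0 =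
    (deg i)%:R * u i 0 + \sum_(j | adj i j && ~~ pos i j) u j 0
      - \sum_(j | adj i j && pos i j) u j 0.
Proof.
rewrite mxE -addrA (bigD1 i) //= !mxE eqxx; congr (_ + _).
rewrite -sumrN [LHS]big_mkcond [X in _ = X + _]big_mkcond [X in _ = _ + X]big_mkcond.
rewrite -big_split /=.
apply: eq_bigr => j _; rewrite !mxE (eq_sym i j).
have [->|ne_ji] := eqVneq j i; first by rewrite edge_irr addr0.
by case: (adj i j); case: (pos i j); rewrite /= ?mulN1r ?mul1r ?mul0r ?(add0r, addr0).
Qed.

Lemma degree_le i : (deg i <= n.+1)%N.
Proof. by rewrite (leq_trans (max_card _)) // card_ord. Qed.

Lemma reduced_laplacian_bound i j : `|L i j| <= n.+1%:Z.
Proof.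
rewrite mxE; case: eqP => _; first by rewrite lez_nat degree_le.
by case: ifP => // _; case: ifP.
Qed.

End ReducedLaplacian.

Section MinimumPrinciple.

Import Order.TTheory GRing.Theory Num.Theory.
Local Open Scope ring_scope.

Variables (n : nat) (G : signed_graph n) (q : 'I_n.+1).

Local Notation L := (reduced_laplacian G q).
Local Notation M := (reduced_laplacian (all_positive G) q).
Local Notation adj i j := (edge G (lift q i) (lift q j)).
Local Notation pos i j := (positive G (lift q i) (lift q j)).
Local Notation deg i := (degree G (lift q i)).
Local Notation "A %:Qm" := (map_mx (intr : int -> rat) A) (at level 2, format "A %:Qm").

Lemma laplacianE (R : nzRingType) (u : 'cV[R]_n) i :
  (map_mx intr M *m u) i 0 = (deg i)%:R * u i 0 - \sum_(j | adj i j) u j 0.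
Proof.
rewrite reduced_laplacianE /= [X in _ + X - _]big_pred0 => [|j]; last by rewrite andbF.
by rewrite addr0; congr (_ - _); apply: eq_bigl => j; rewrite andbT.
Qed.

Definition extend_by_zero (u : 'cV[rat]_n) (v : 'I_n.+1) : rat :=
  if unlift q v is Some j then u j 0 else 0.

(** The degree counts an edge to the sink as well; holding the sink at 0 makes
    that edge contribute a difference like any other. *)
Lemma laplacian_differences (u : 'cV[rat]_n) i :
  (M%:Qm *m u) i 0 =
    \sum_(v | edge G (lift q i) v) (u i 0 - extend_by_zero u v).
Proof.
rewrite laplacianE sumrB sumr_const mulr_natl -cardsE; congr (_ - _).
rewrite sum_neighbours /extend_by_zero unlift_none mul0rn add0r.
by apply: eq_bigr => j _; rewrite liftK.
Qed.

Hypothesis G_connected : connected_graph G.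

(** At a minimum with a negative value, every difference with a neighbour is
    nonpositive, while their sum is nonnegative; so all neighbours share the
    minimum. By connectivity the sink would share it too, but there the value
    is 0. *)
Lemma minimum_principle (u : 'cV[rat]_n) :
  (forall i, 0 <= (M%:Qm *m u) i 0) -> forall i, 0 <= u i 0.
Proof.
move=> Mu_ge0 i0; set w := extend_by_zero u.
have w_lift j : w (lift q j) = u j 0 by rewrite /w /extend_by_zero liftK.
case: (@arg_minP _ _ _ q xpredT w isT) => v0 _ w_min; set m := w v0 in w_min.
suff m_ge0 : 0 <= m by rewrite -w_lift (le_trans m_ge0) ?w_min.
rewrite leNgt; apply/negP => m_lt0.
have q_a : w q != m by rewrite /w /extend_by_zero unlift_none gt_eqF.
(* The set of minimisers is closed under passing to neighbours. *)
pose a := [pred v | w v == m].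
suff a_closed : closed (edge G) a.
  by have := closed_connect a_closed (G_connected v0 q); rewrite !inE eqxx (negPf q_a).
apply: intro_closed => [x y|x y xy /eqP wx]; first by rewrite !G_connected.
case: (unliftP q x) => [i|] def_x; last by rewrite -def_x wx eqxx in q_a.
have := Mu_ge0 i; rewrite laplacian_differences -w_lift -def_x wx => sum_ge0.
have le0 v : edge G x v -> 0 <= w v - m by rewrite subr_ge0 w_min.
have : \sum_(v | edge G x v) (w v - m) == 0.
  rewrite eq_le sumr_ge0 // andbT -oppr_ge0 -sumrN.
  by under eq_bigr do rewrite opprB.
by rewrite psumr_eq0 // => /allP/(_ y); rewrite mem_index_enum xy subr_eq0 => /(_ isT).
Qed.

(** If [L u = 0], the triangle inequality gives [M |u| <= 0] whatever the signs
    are, and the minimum principle for [- |u|] yields [u = 0]. *)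
Lemma laplacian_kernel (u : 'cV[rat]_n) : L%:Qm *m u = 0 -> u = 0.
Proof.
move=> Lu0.
have abs_le0 : forall i, 0 <= (- map_mx Num.norm u) i 0.
  apply: minimum_principle => i; rewrite laplacianE !mxE.
  under eq_bigr => j _ do rewrite !mxE.
  rewrite sumrN opprK mulrN addrC subr_ge0.
  have := reduced_laplacianE G q u i; rewrite Lu0 mxE => /eqP.
  rewrite eq_sym -addrA addr_eq0 => /eqP E.
  rewrite -normr_nat -normrM E normrN.
  apply: le_trans (ler_normB _ _) _.
  rewrite [leRHS](bigID (fun j => pos i j)) /= [leRHS]addrC.
  by apply: lerD; apply: ler_norm_sum.
apply/colP => i; have := abs_le0 i.
by rewrite !mxE oppr_ge0 normr_le0 => /eqP.
Qed.

Lemma reduced_laplacian_unit : L%:Qm \in unitmx.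
Proof.
rewrite unitmxE unitfE -det_tr; apply/det0P => -[v v_neq0 vL].
case/negP: v_neq0; rewrite -trmx_eq0; apply/eqP/laplacian_kernel.
by apply: trmx_inj; rewrite trmx_mul trmxK vL trmx0.
Qed.

End MinimumPrinciple.

(** * Solving over the integers, with bounds *)

Section IntegerSolutions.

Import Order.TTheory GRing.Theory Num.Theory.
Local Open Scope ring_scope.

(** Cramer's rule without division. *)
Lemma scaled_inverse n (A : 'M[int]_n) (b : 'cV[int]_n) :
  exists z, A *m z = `|\det A| *: b.
Proof.
exists (Num.sg (\det A) *: (\adj A *m b)).
by rewrite -scalemxAr mulmxA mul_mx_adj mul_scalar_mx scalerA -normrEsg.
Qed.

Lemma det_bound m (A : 'M[int]_m) (b : nat) :
  (forall i j, `|A i j| <= b%:Z) -> `|\det A| <= (m`! * b ^ m)%N%:Z.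
Proof.
move=> A_le; apply: le_trans (ler_norm_sum _ _ _) _.
have -> : (m`! * b ^ m)%N%:Z = \sum_(s : 'S_m) \prod_(i < m) b%:Z.
  by rewrite sumr_const prodr_const card_ord card_Sn -mulr_natl -[b%:Z]natz -natrX -natrM natz.
apply: ler_sum => s _; rewrite normrM normrX normrN1 expr1n mul1r normr_prod.
by apply: ler_prod => i _; rewrite normr_ge0 A_le.
Qed.

(** A bound for the determinants of integer matrices whose entries are at most
    [n + 1] in absolute value, such as both reduced Laplacians. *)
Definition det_max n := (n`! * n.+1 ^ n)%N.

Lemma adjugate_bound n (A : 'M[int]_n) :
  (forall i j, `|A i j| <= n.+1%:Z) -> forall i j, `|(\adj A) i j| <= (det_max n)%:Z.
Proof.
move=> A_le i j; rewrite mxE normrM normrX normrN1 expr1n mul1r.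
apply: le_trans (det_bound (b := n.+1) _) _ => [i' j'|]; first by rewrite !mxE.
rewrite lez_nat /det_max; case: n {A A_le j} i => [[]//|n] _ /=.
by rewrite leq_mul ?leq_exp2l // factS leq_pmull.
Qed.

(** A common multiple of all positive integers up to [det_max n], hence of the
    determinant of [L]: it clears the denominators of the inverse of [L] although
    that determinant is never computed. *)
Definition denominator n := (det_max n)`!.

Lemma denominator_gt0 n : (0 < denominator n)%N.
Proof. exact: fact_gt0. Qed.

(** A bound for the entries of the inverse of [M] applied to a vector with
    entries between 0 and [n + 1]. *)
Definition potential_max n := (n.+1 * (n * det_max n))%N.

End IntegerSolutions.

(** * Chip-firing on the underlying graph *)

Section Configurations.

Import Order.TTheory GRing.Theory Num.Theory.
Local Open Scope ring_scope.

Variables (n : nat) (G : signed_graph n) (q : 'I_n.+1).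

Local Notation L := (reduced_laplacian G q).
Local Notation M := (reduced_laplacian (all_positive G) q).
Local Notation adj i j := (edge G (lift q i) (lift q j)).
Local Notation deg i := (degree G (lift q i)).
Local Notation "A %:Qm" := (map_mx (intr : int -> rat) A) (at level 2, format "A %:Qm").

(** The number of chips that reach [i] when every site of [T] fires once. *)
Definition inner_degree (T : {set 'I_n}) (i : 'I_n) : nat := (\sum_(j in T) adj i j)%N.

Definition indicator (T : {set 'I_n}) : 'cV[int]_n := \col_i (i \in T)%:R.

Lemma laplacian_intE (z : 'cV[int]_n) i :
  (M *m z) i 0 = (deg i)%:R * z i 0 - \sum_(j | adj i j) z j 0.
Proof.
rewrite -(laplacianE G q z i); congr ((_ *m _) _ _).
by apply/matrixP => j k; rewrite !mxE intz.
Qed.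

Lemma laplacian_indicator T i :
  (M *m indicator T) i 0 = (deg i)%:R * (i \in T)%:R - (inner_degree T i)%:R.
Proof.
rewrite laplacian_intE mxE; congr (_ - _).
under eq_bigr do rewrite mxE.
rewrite natr_sum big_mkcond [RHS]big_mkcond; apply: eq_bigr => j _.
by case: (adj i j); case: (j \in T).
Qed.

Lemma inner_degree_le T i : (inner_degree T i + inner_degree (~: T) i <= deg i)%N.
Proof.
rewrite (degreeE G q i) [X in (_ <= _ + X)%N](bigID (mem T)) /= /inner_degree.
by under [X in (_ + X <= _)%N]eq_bigl do rewrite inE; apply: leq_addl.
Qed.

(** On the set where [z] is maximal, [M z] is at least what firing that set once
    would remove: each neighbour outside the set has a value smaller by at least
    1, and the row sums of [M] are nonnegative. Both halves of the theory of
    stable configurations rest on this. *)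
Lemma top_level_set (z : 'cV[int]_n) :
    z != 0 -> (forall i, 0 <= z i 0) ->
  exists2 T : {set 'I_n}, T != set0 &
    forall i, i \in T -> 0 < z i 0 /\ (deg i)%:R - (inner_degree T i)%:R <= (M *m z) i 0.
Proof.
move=> z_neq0 z_ge0.
have [i0 zi0] : exists i0, z i0 0 != 0.
  apply/existsP; rewrite -negb_forall; apply: contraNN z_neq0 => /forallP z0.
  by apply/eqP/colP => i; rewrite mxE; apply/eqP.
case: (@arg_maxP _ _ _ i0 xpredT (fun i => z i 0) isT) => i1 _ z_max.
set m := z i1 0 in z_max.
have z_le j : z j 0 <= m by exact: z_max.
have m_gt0 : 0 < m by rewrite (lt_le_trans _ (z_le i0)) // lt_def zi0 z_ge0.
pose T := [set i | z i 0 == m].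
exists T => [|i]; first by apply/set0Pn; exists i1; rewrite inE.
rewrite inE => /eqP zi; rewrite zi; split=> //.
(* Neighbours in the top set have the value [m], the others at most [m - 1]. *)
have sum_le : \sum_(j | adj i j) z j 0 <=
    (inner_degree T i)%:R * m + (inner_degree (~: T) i)%:R * (m - 1).
  rewrite [leLHS]big_mkcond (bigID (mem T)) /= !natr_sum !mulr_suml.
  apply: lerD; rewrite big_mkcond [leRHS]big_mkcond; apply: ler_sum => j _; rewrite !inE.
    by case: eqP => // ->; case: (adj i j); rewrite ?mul1r ?mul0r.
  case: eqP => //= /eqP zj; case: (adj i j); rewrite ?mul1r ?mul0r //.
  by rewrite -ltzD1 subrK lt_neqAle zj z_le.
rewrite laplacian_intE zi.
have := inner_degree_le T i; move: (inner_degree _ _) (inner_degree _ _) sum_le.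
move: (\sum_(j | adj i j) _) => s a b; nia.
Qed.

(** With [c = L y], firing site [i] lowers the potential [y] by [e_i], and
    [chips c = M y] is an ordinary configuration on the unsigned graph, with
    rational numbers of chips, which loses [M e_i]. *)
Definition potential (c : 'cV[int]_n) : 'cV[rat]_n := invmx L%:Qm *m c%:Qm.

Definition chips (c : 'cV[int]_n) : 'cV[rat]_n := M%:Qm *m potential c.

Lemma validP c : reflect (valid G q c) [forall i, 0 <= chips c i 0].
Proof. by rewrite /chips /potential mulmxA; exact: forallP. Qed.

Hypothesis G_connected : connected_graph G.

Lemma potential_sub c z : potential (c - L *m z) = potential c - z%:Qm.
Proof.
by rewrite /potential map_mxB map_mxM mulmxBr mulKmx // reduced_laplacian_unit.
Qed.

Lemma chips_sub c z i : chips (c - L *m z) i 0 = chips c i 0 - ((M *m z) i 0)%:~R.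
Proof. by rewrite /chips potential_sub mulmxBr -map_mxM !mxE. Qed.

Lemma chips_sub_indicator c T i :
  chips (c - L *m indicator T) i 0 =
    chips c i 0 - (if i \in T then (deg i)%:R else 0) + (inner_degree T i)%:R.
Proof.
rewrite chips_sub laplacian_indicator rmorphB rmorphM /= !rmorph_nat.
by case: (i \in T); rewrite ?mulr1 ?mulr0; lra.
Qed.

Lemma chips_fire c j i :
  chips (fire G q c j) i 0 =
    chips c i 0 + (if i == j then - (deg i)%:R else (adj i j)%:R).
Proof.
have -> : fire G q c j = c - L *m indicator [set j].
  rewrite /fire; congr (_ - _ *m _); apply/colP => k.
  by rewrite !mxE inE eqxx andbT.
rewrite chips_sub_indicator inE /inner_degree big_set1.
by case: eqP => [->|_]; rewrite ?edge_irr ?addr0 ?subr0.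
Qed.

(** Firing vectors may be tested on indicators of sets only: when [z] is legal to
    fire, so is the set of sites where [z] is maximal. *)
Lemma z_superstable_iff c :
  z_superstable G q c <->
  (forall i, 0 <= chips c i 0) /\
  forall T : {set 'I_n}, T != set0 ->
    exists2 i, i \in T & chips c i 0 < (deg i)%:R - (inner_degree T i)%:R.
Proof.
split=> [[/validP/forallP c_valid c_stable]|[c_valid c_stable]].
  split=> // T T_neq0; pose z := indicator T.
  have : ~ valid G q (c - L *m z).
    apply: c_stable => [|i]; last by rewrite mxE ler0n.
    have [i iT] := set0Pn _ T_neq0; apply/eqP => /colP/(_ i).
    by rewrite !mxE iT.
  move/validP; rewrite negb_forall => /existsP[i]; rewrite -ltNge chips_sub_indicator.
  have := c_valid i; have := ler0n rat (inner_degree T i).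
  case iT: (i \in T) => /= inner_ge0 chips_ge0 lt0; first by exists i => //; lra.
  by exfalso; lra.
split; first exact/validP/forallP.
move=> z z_neq0 z_ge0 /validP/forallP.
have [T T_neq0 T_top] := top_level_set z_neq0 z_ge0.
have [i iT lt_i] := c_stable T T_neq0 => /(_ i); rewrite chips_sub.
have [_] := T_top i iT; rewrite -(ler_int rat) rmorphB /= !rmorph_nat.
by move=> *; lra.
Qed.

Lemma readyE c i : valid G q c -> ready G q c i <-> (deg i)%:R <= chips c i 0.
Proof.
move=> /validP/forallP c_valid; split=> [/validP/forallP/(_ i)|le_i].
  by rewrite chips_fire eqxx; lra.
apply/validP/forallP => j; rewrite chips_fire; have := c_valid j.
have [->|_] := eqVneq j i; first lra.
by have := ler0n rat (adj j i); lra.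
Qed.

Lemma stable_iff c :
  stable G q c <-> forall i, 0 <= chips c i 0 < (deg i)%:R.
Proof.
split=> [[c_valid c_stable] i|c_stable].
  have /validP/forallP -> /= := c_valid.
  by rewrite ltNge; apply/negP => /(readyE i c_valid) /c_stable.
have c_valid : valid G q c by apply/validP/forallP => i; case/andP: (c_stable i).
by split=> // i /(readyE i c_valid); case/andP: (c_stable i) => _; rewrite ltNge => /negP.
Qed.

Local Notation fires := (foldl (fire G q)).

Definition legal (d : 'cV[int]_n) (s : seq 'I_n) : Prop :=
  forall l, (l <= size s)%N -> valid G q (fires d (take l s)).

Lemma legal_rcons d s j : legal d (rcons s j) -> legal d s /\ valid G q (fires d (rcons s j)).
Proof.
move=> dsj; split=> [l le_l|]; last first.
  by have := dsj (size s).+1; rewrite -(size_rcons s j) take_size => /(_ (leqnn _)).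
by have := dsj l; rewrite size_rcons -cats1 takel_cat //; apply; apply: leqW.
Qed.

Lemma chips_unfired d s i :
  i \notin s -> chips d i 0 <= chips (fires d s) i 0.
Proof.
elim: s d => [|j s IH] d //=; rewrite inE negb_or => /andP[ne_ij i_s].
apply: le_trans (IH _ i_s); rewrite chips_fire (negPf ne_ij).
by have := ler0n rat (adj i j); lra.
Qed.

(** Among the sites of [T], the one whose last firing comes first has received,
    since then, a chip from each of its neighbours in [T]. The induction on the
    word expresses this by removing the site [j] fired last: the other sites of
    [T] gain the chip that [j] sends them. *)
Lemma fired_not_forbidden d s (T : {set 'I_n}) :
    legal d s -> T != set0 -> {subset T <= s} ->
  exists2 i, i \in T & (inner_degree T i)%:R <= chips (fires d s) i 0.
Proof.
elim/last_ind: s T => [|s j IH] T; first by move=> _ /set0Pn[i iT] /(_ i iT).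
move=> /legal_rcons[ds valid_sj] T_neq0 sTs.
have T'_s : {subset T :\ j <= s}.
  by move=> i /setD1P[ne_ij /sTs]; rewrite mem_rcons inE (negPf ne_ij).
have [T'0|T'_neq0] := eqVneq (T :\ j) set0.
  have [i iT] := set0Pn _ T_neq0; exists i => //.
  have only_j k : k \in T -> k = j.
    move=> kT; apply: contraTeq kT => ne_kj.
    by have := in_set0 k; rewrite -T'0 !inE ne_kj /= => ->.
  rewrite /inner_degree big1 => [|k /only_j ->]; first by have /validP/forallP := valid_sj.
  by rewrite (only_j i iT) edge_irr.
have [i iT'] := IH _ ds T'_neq0 T'_s.
have [ne_ij iT] := setD1P iT'; move=> le_i; exists i => //.
rewrite -cats1 foldl_cat /= chips_fire (negPf ne_ij).
have : (inner_degree T i <= inner_degree (T :\ j) i + adj i j)%N.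
  rewrite /inner_degree; case jT: (j \in T).
    rewrite (bigD1 j) //= addnC leq_add2r big_mkcond [leqRHS]big_mkcond.
    by apply: leq_sum => k _; rewrite !inE andbC.
  apply: leq_trans (leq_addr _ _); apply: eq_leq; apply: eq_bigl => k.
  by rewrite !inE; case: eqP => // ->.
by rewrite -(ler_nat rat) natrD; lra.
Qed.

(** Among the sites where the remaining firing vector [z] is maximal, one has at
    least its inner degree already in [c]; adding what [M z] contributes there,
    it has its full degree and can fire. *)
Lemma fire_down c (z : 'cV[int]_n) :
    valid G q c ->
    (forall T : {set 'I_n}, T != set0 ->
       exists2 i, i \in T & (inner_degree T i)%:R <= chips c i 0) ->
    (forall i, 0 <= z i 0) -> valid G q (c + L *m z) ->
  exists s, c = fires (c + L *m z) s /\ legal (c + L *m z) s.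
Proof.
move=> c_valid c_rec.
have [m] := ubnP (\sum_i absz (z i 0%R))%N; elim: m z => // m IH z le_zm z_ge0 z_valid.
have [->|z_neq0] := eqVneq z 0.
  exists [::]; rewrite /= mulmx0 addr0; split=> // -[].
have [T T_neq0 T_top] := top_level_set z_neq0 z_ge0.
have [i iT le_i] := c_rec T T_neq0; have [zi_gt0 top_i] := T_top i iT.
pose z' := z - delta_mx i 0.
have fire_z : fire G q (c + L *m z) i = c + L *m z'.
  by rewrite /fire /z' mulmxBr addrA.
have ready_i : valid G q (c + L *m z').
  rewrite -fire_z; apply/(readyE i z_valid).
  have -> : c + L *m z = c - L *m (- z) by rewrite mulmxN opprK.
  rewrite chips_sub mulmxN [X in _ - X%:~R]mxE rmorphN opprK /=.
  move: top_i; rewrite -(ler_int rat) rmorphB /= !rmorph_nat; lra.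
have z'E j : z' j 0 = z j 0 - (j == i)%:R by rewrite !mxE andbT.
have [|j|s [c_s legal_s]] := IH z' _ _ ready_i.
- move: le_zm; rewrite ltnS (bigD1 i) // [X in _ -> (X < _)%N](bigD1 i) //= z'E eqxx.
  under [X in _ -> (_ + X < _)%N]eq_bigr => j ne_ji do rewrite z'E (negPf ne_ji) subr0.
  by move: zi_gt0 => /=; lia.
- by rewrite z'E; case: eqP => [->|_]; rewrite ?subr0 //; lia.
exists (i :: s); rewrite /= fire_z; split=> // -[|l] //= le_l.
by rewrite fire_z; apply: legal_s.
Qed.

Lemma laplacian_det_neq0 : \det M != 0.
Proof.
have M_connected : connected_graph (all_positive G) by exact: G_connected.
have := reduced_laplacian_unit q M_connected.
by rewrite unitmxE unitfE det_map_mx /= intr_eq0.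
Qed.

Lemma laplacian_ge0 (z : 'cV[int]_n) :
  (forall i, 0 <= (M *m z) i 0) -> forall i, 0 <= z i 0.
Proof.
move=> Mz_ge0 i; have := @minimum_principle _ G q G_connected z%:Qm _ i.
rewrite mxE ler0z; apply=> j.
by rewrite -map_mxM mxE ler0z.
Qed.

(** This is Dhar's burning criterion. A stable configuration reached from one in
    which every site is ready has fired every site, so every set of sites has
    been fired. Conversely [d = c + L z] has every site ready as soon as [M z]
    dominates the degrees, and [d] fires down to [c]. *)
Lemma critical_iff c :
  critical G q c <->
  (forall i, 0 <= chips c i 0 < (deg i)%:R) /\
  forall T : {set 'I_n}, T != set0 ->
    exists2 i, i \in T & (inner_degree T i)%:R <= chips c i 0.
Proof.
split=> [[/stable_iff c_stable [c_valid [d [d_valid d_ready [s [c_s legal_s]]]]]]|].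
  split=> // T T_neq0; rewrite c_s; apply: fired_not_forbidden => // i _.
  apply: contraT => /(chips_unfired d); rewrite -c_s leNgt => /negP[].
  have /andP[_ lt_i] := c_stable i.
  by apply: lt_le_trans lt_i _; apply/(readyE i d_valid).
move=> [c_stable c_rec]; split; first exact/stable_iff.
have c_valid : valid G q c by apply/validP/forallP => i; case/andP: (c_stable i).
split=> //.
(* Adding [L z] to [c] gives every site at least as many chips as its degree. *)
have [z Mz] := scaled_inverse M (\col_i (deg i)%:R).
have MzE i : (M *m z) i 0 = `|\det M| * (deg i)%:R by rewrite Mz !mxE.
have z_ge0 : forall i, 0 <= z i 0.
  by apply: laplacian_ge0 => i; rewrite MzE mulr_ge0.
have chips_d i : chips (c + L *m z) i 0 = chips c i 0 + ((M *m z) i 0)%:~R.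
  have -> : c + L *m z = c - L *m (- z) by rewrite mulmxN opprK.
  by rewrite chips_sub mulmxN [X in _ - X%:~R]mxE rmorphN opprK.
have le_Mz i : (deg i)%:R <= ((M *m z) i 0)%:~R :> rat.
  rewrite MzE rmorphM /= rmorph_nat ler_peMl // ler1z -gtz0_ge1 normr_gt0.
  exact: laplacian_det_neq0.
have d_valid : valid G q (c + L *m z).
  apply/validP/forallP => i; rewrite chips_d.
  have /andP[c_ge0 _] := c_stable i.
  by rewrite addr_ge0 // (le_trans _ (le_Mz i)).
have [s [c_s legal_s]] := fire_down c_valid c_rec z_ge0 d_valid.
exists (c + L *m z); split=> // [i|]; last by exists s.
apply/(readyE i d_valid); rewrite chips_d.
have /andP[c_ge0 _] := c_stable i.
by apply: le_trans (le_Mz i) _; rewrite lerDr.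
Qed.

Lemma solution_potential (c Y : 'cV[int]_n) :
    L *m Y = (denominator n)%:Z *: c ->
  forall i, (Y i 0)%:~R = (denominator n)%:R * potential c i 0.
Proof.
move=> LY i.
have LYq : L%:Qm *m Y%:Qm = (denominator n)%:R *: c%:Qm by rewrite -map_mxM LY map_mxZ.
transitivity (Y%:Qm i 0); first by rewrite [RHS]mxE.
rewrite -(mulKmx (reduced_laplacian_unit q G_connected) Y%:Qm) LYq.
by rewrite -scalemxAr mxE.
Qed.

Lemma solution_chips (c Y : 'cV[int]_n) :
    L *m Y = (denominator n)%:Z *: c ->
  forall i, ((M *m Y) i 0)%:~R = (denominator n)%:R * chips c i 0.
Proof.
move=> /solution_potential Yq i.
transitivity ((M *m Y)%:Qm i 0); first by rewrite [RHS]mxE.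
have -> : (M *m Y)%:Qm = M%:Qm *m ((denominator n)%:R *: potential c).
  by rewrite map_mxM; congr (_ *m _); apply/colP => j; rewrite [RHS]mxE -Yq mxE.
by rewrite -scalemxAr [LHS]mxE.
Qed.

(** The determinant of [L] is nonzero and at most [det_max n] in absolute value,
    so it divides the common denominator. *)
Lemma solution_exists (c : 'cV[int]_n) :
  exists Y : 'cV[int]_n, L *m Y = (denominator n)%:Z *: c.
Proof.
have [z Lz] := scaled_inverse L c.
have det_gt0 : (0 < `|\det L|)%N.
  have := reduced_laplacian_unit q G_connected.
  by rewrite unitmxE unitfE det_map_mx /= intr_eq0 absz_gt0.
have : (`|\det L| %| denominator n)%N.
  apply: dvdn_fact; rewrite det_gt0 /= -lez_nat abszE.
  exact/det_bound/reduced_laplacian_bound.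
case/dvdnP => m def_D; exists (m%:Z *: z).
by rewrite -scalemxAr Lz scalerA def_D PoszM abszE.
Qed.

(** The inverse of [M] is nonnegative, so the potential of a configuration with
    fewer chips than degrees is bounded by the potential of the constant
    configuration [n + 1], which the adjugate of [M] bounds. *)
Lemma potential_le (c : 'cV[int]_n) :
    (forall i, 0 <= chips c i 0 < (deg i)%:R) ->
  forall i, 0 <= potential c i 0 <= (potential_max n)%:R.
Proof.
move=> c_stable.
(* The multiple of [M^-1 1] by [|det M| >= 1]; [n + 1] times it dominates the
   potential of [c]. *)
pose one : 'cV[int]_n := const_mx 1.
pose z := Num.sg (\det M) *: (\adj M *m one).
have Mz : M *m z = `|\det M| *: one.
  by rewrite /z -scalemxAr mulmxA mul_mx_adj mul_scalar_mx scalerA -normrEsg.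
have z_le i : z i 0 <= (n * det_max n)%N%:Z.
  rewrite mxE; apply: le_trans (ler_norm _) _; rewrite normrM normr_sg.
  rewrite laplacian_det_neq0 // mul1r mxE; apply: le_trans (ler_norm_sum _ _ _) _.
  have -> : (n * det_max n)%N%:Z = \sum_(j < n) (det_max n)%:Z.
    by rewrite sumr_const card_ord -mulr_natl PoszM natz.
  apply: ler_sum => j _; rewrite [const_mx _ _ _]mxE mulr1.
  exact/adjugate_bound/(reduced_laplacian_bound (all_positive G)).
move=> i; apply/andP; split.
  apply: (minimum_principle (q := q) G_connected) => j.
  by case/andP: (c_stable j).
have : forall j, 0 <= (M%:Qm *m (n.+1%:R *: z%:Qm - potential c)) j 0.
  move=> j; rewrite mulmxBr -scalemxAr -map_mxM Mz -/(chips c).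
  rewrite mxE [X in _ + X]mxE subr_ge0.
  have /andP[_ /ltW le_deg] := c_stable j; move: (chips c j 0) le_deg => x le_deg.
  rewrite !mxE mulr1; apply: le_trans le_deg _.
  apply: (@le_trans _ _ n.+1%:R); first by rewrite ler_nat degree_le.
  rewrite ler_peMr // ler1z -gtz0_ge1 normr_gt0; exact: laplacian_det_neq0.
move=> /(minimum_principle (q := q) G_connected)/(_ i).
rewrite mxE [X in _ + X]mxE subr_ge0 => le_i; apply: le_trans le_i _.
rewrite mxE [X in _ * X]mxE /potential_max natrM ler_wpM2l //.
by have := z_le i; rewrite -(ler_int rat).
Qed.

Lemma stable_bounds (c : 'cV[int]_n) :
    (forall i, 0 <= chips c i 0 < (deg i)%:R) ->
  forall i, `|c i 0| <= (n * n.+1 * potential_max n)%N%:Z.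
Proof.
move=> /potential_le pot_le i; rewrite -(ler_int rat) intr_norm.
have -> : (c i 0)%:~R = (L%:Qm *m potential c) i 0.
  by rewrite /potential mulKVmx ?reduced_laplacian_unit // [RHS]mxE.
rewrite [X in `|X|]mxE; apply: le_trans (ler_norm_sum _ _ _) _.
have -> : (n * n.+1 * potential_max n)%N%:Z%:~R =
    \sum_(j < n) (n.+1%:R * (potential_max n)%:R) :> rat.
  by rewrite sumr_const card_ord -natrM -mulrnA [in RHS]mulnC [in RHS]mulnA.
apply: ler_sum => j _; have /andP[pot_ge0 pot_le_j] := pot_le j.
rewrite normrM (ger0_norm pot_ge0) ler_pM // [X in `|X|]mxE.
by rewrite -intr_norm -[leRHS]/(n.+1%:Z%:~R) ler_int reduced_laplacian_bound.
Qed.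

Lemma solution_bounds (c Y : 'cV[int]_n) :
    (forall i, 0 <= chips c i 0 < (deg i)%:R) ->
    L *m Y = (denominator n)%:Z *: c ->
  forall i, 0 <= Y i 0 <= (denominator n * potential_max n)%N%:Z.
Proof.
move=> /potential_le pot_le /solution_potential Yq i.
have /andP[pot_ge0 pot_le_i] := pot_le i.
rewrite -(ler0z rat) -(ler_int rat) Yq mulr_ge0 //=.
by rewrite -[leRHS]/((denominator n * potential_max n)%N%:R) natrM ler_wpM2l.
Qed.

End Configurations.

(** * The decision procedure *)

(** Here [g] is the argument list of the program: the number of nonsink vertices,
    the sink, and the code of the list of edge labels. *)
Definition nsites (g : seq nat) := nth 0 g 0.

Definition entry (y j : nat) := nth 0 (decode y) j.

(** The labels are listed row by row, for all pairs among [nsites g + 1]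
    vertices. *)
Definition label g (u v : nat) := entry (nth 0 g 2) (u * (nsites g).+1 + v).

(** The vertex [lift q i], as a natural number. *)
Definition site g (i : nat) := bump (nth 0 g 1) i.

Definition degree_at g i := \sum_(0 <= v < (nsites g).+1) (label g (site g i) v != 0).

(** Label 1 marks positive edges and label 2 negative edges, so sums with [s = 1]
    and [s = 2] are the off-diagonal parts of [L] with either sign. *)
Definition neighbour_sum (s : nat) g (v : nat -> nat) i :=
  \sum_(0 <= j < nsites g) (label g (site g i) (site g j) == s) * v j.

Definition total_neighbour_sum g v i := neighbour_sum 1 g v i + neighbour_sum 2 g v i.

(** The code [e] of an integer is twice its value when that is nonnegative, and
    an odd number when it is negative; an integer is handled as the difference
    of its two parts to stay within the natural numbers. *)
Definition pos_part (e : nat) := \sum_(0 <= h < e) (h.*2 == e) * h.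

Definition neg_part (e : nat) := \sum_(0 <= h < e) (h.*2.+1 == e) * h.+1.

(** Large enough for the codes of the entries of stable configurations and for
    the entries of their scaled potentials. *)
Definition coefficient_max n := (denominator n * (n.+1 * n.+1 * potential_max n)).*2.+1.

(** The code of the sequence made of [n] times [b]. *)
Definition code_bound b n := iteri n (fun _ u => 2 ^ b * u.*2.+1) 0.

Definition search_bound n := (code_bound (coefficient_max n) n).+1.

(** Row [i] of [L y = D c], where [D] is the common denominator, with the
    negative terms moved to the other side. *)
Definition is_solution g c y i :=
  degree_at g i * entry y i + neighbour_sum 2 g (entry y) i
    + denominator (nsites g) * neg_part (entry c i)
  == neighbour_sum 1 g (entry y) i + denominator (nsites g) * pos_part (entry c i).

(** [y] codes the scaled potential of [c], and [c] is valid. *)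
Definition represents g c y :=
  all (fun i => is_solution g c y i &&
         (total_neighbour_sum g (entry y) i <= degree_at g i * entry y i))
    (iota 0 (nsites g)).

(** Truncation is harmless here: [represents] forces the difference to be
    nonnegative. *)
Definition chips_at g y i := degree_at g i * entry y i - total_neighbour_sum g (entry y) i.

Definition inner_degree_at g t i := total_neighbour_sum g (fun j => entry t j != 0) i.

(** A code [t] stands for the set of sites at which it has a nonzero entry. *)
Definition every_subset g (R : nat -> nat -> bool) :=
  all (fun t => has (fun i => entry t i != 0) (iota 0 (nsites g)) ==>
                has (fun i => (entry t i != 0) && R t i) (iota 0 (nsites g)))
    (iota 0 (search_bound (nsites g))).

Definition superstable_test g c :=
  (size (decode c) == nsites g) &&
  has (fun y => represents g c y && every_subset g (fun t i =>
         chips_at g y i + denominator (nsites g) * inner_degree_at g t i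
           < denominator (nsites g) * degree_at g i))
    (iota 0 (search_bound (nsites g))).

Definition below_degree g y :=
  all (fun i => chips_at g y i < denominator (nsites g) * degree_at g i)
    (iota 0 (nsites g)).

Definition critical_test g c :=
  (size (decode c) == nsites g) &&
  has (fun y => [&& represents g c y, below_degree g y & every_subset g (fun t i =>
         denominator (nsites g) * inner_degree_at g t i <= chips_at g y i)])
    (iota 0 (search_bound (nsites g))).

(** * Computability of the procedure *)

Section Computability.

Implicit Types (k : nat) (inp : seq nat -> seq nat).

(** [inp] recovers the program's arguments from an argument list in front of which
    bound variables have been pushed. *)
Definition reads k inp := forall j, computable k (fun xs => nth 0 (inp xs) j).

Lemma reads_weaken k inp : reads k inp -> reads k.+1 (fun xs => inp (behead xs)).
Proof. by move=> inpP j; apply: (@computable_weaken _ (fun xs => nth 0 (inp xs) j)). Qed.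

Lemma computable_entry k y j :
  computable k y -> computable k j -> computable k (fun xs => entry (y xs) (j xs)).
Proof. exact: computable_nth. Qed.

Lemma computable_proj_behead k i : computable k (fun xs => nth 0 (behead xs) i).
Proof.
apply: (@computable_ext _ (fun xs => nth 0 xs i.+1)) => [[]|]; rewrite ?nth_nil //.
exact: computable_proj.
Qed.

Variables (k : nat) (inp : seq nat -> seq nat).
Hypothesis inpP : reads k inp.

Lemma computable_nsites : computable k (fun xs => nsites (inp xs)).
Proof. exact: inpP. Qed.

Lemma computable_label u v :
    computable k u -> computable k v ->
  computable k (fun xs => label (inp xs) (u xs) (v xs)).
Proof.
move=> uP vP; apply: computable_entry; first exact: inpP.
by apply: computable_add => //; apply: computable_mul => //; apply/computable_succ/inpP.
Qed.

Lemma computable_site i : computable k i -> computable k (fun xs => site (inp xs) (i xs)).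
Proof.
move=> iP; apply: computable_add => //.
by apply: decidable_leq => //; apply: inpP.
Qed.

End Computability.

(** A function that is a parameter occurs under one [behead] for each enclosing
    bound variable, hence the three weakenings. *)
Ltac computability :=
  repeat first
    [ assumption
    | apply: computable_proj | apply: computable_proj_behead | apply: computable_const
    | apply: reads_weaken
    | apply: computable_weaken3; assumption
    | apply: computable_weaken2; assumption
    | apply: computable_weaken; assumption
    | apply: computable_nsites | apply: computable_label | apply: computable_site
    | apply: computable_entry
    | apply: computable_succ | apply: computable_double | apply: computable_add
    | apply: computable_mul | apply: computable_sub | apply: computable_expn
    | apply: computable_factorial
    | apply: decidable_neg | apply: decidable_and | apply: decidable_implies
    | apply: decidable_leq | apply: decidable_eq ].

Lemma computable_degree_at k inp i :
    reads k inp -> computable k i ->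
  computable k (fun xs => degree_at (inp xs) (i xs)).
Proof.
move=> inpP iP.
apply: (computable_sum (F := fun v xs =>
  label (inp xs) (site (inp xs) (i xs)) v != 0)); first by computability.
by computability.
Qed.

Lemma computable_neighbour_sum k inp s (v : nat -> seq nat -> nat) i :
    reads k inp -> computable k i ->
    computable k.+1 (fun xs => v (nth 0 xs 0) (behead xs)) ->
  computable k (fun xs => neighbour_sum s (inp xs) (fun j => v j xs) (i xs)).
Proof.
move=> inpP iP vP.
apply: (computable_sum (F := fun j xs =>
  (label (inp xs) (site (inp xs) (i xs)) (site (inp xs) j) == s) * v j xs)).
  by computability.
by computability.
Qed.

Lemma computable_total_neighbour_sum k inp (v : nat -> seq nat -> nat) i :
    reads k inp -> computable k i ->
    computable k.+1 (fun xs => v (nth 0 xs 0) (behead xs)) ->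
  computable k (fun xs => total_neighbour_sum (inp xs) (fun j => v j xs) (i xs)).
Proof. by move=> *; apply: computable_add; apply: computable_neighbour_sum. Qed.

Lemma computable_pos_part k e : computable k e -> computable k (fun xs => pos_part (e xs)).
Proof.
move=> eP; apply: (computable_sum (F := fun h xs => (h.*2 == e xs) * h)) => //.
by computability.
Qed.

Lemma computable_neg_part k e : computable k e -> computable k (fun xs => neg_part (e xs)).
Proof.
move=> eP; apply: (computable_sum (F := fun h xs => (h.*2.+1 == e xs) * h.+1)) => //.
by computability.
Qed.

Lemma computable_denominator k n :
  computable k n -> computable k (fun xs => denominator (n xs)).
Proof. by move=> nP; rewrite /denominator /det_max; computability. Qed.

Lemma computable_coefficient_max k n :
  computable k n -> computable k (fun xs => coefficient_max (n xs)).
Proof.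
move=> nP; rewrite /coefficient_max /potential_max /det_max.
by have denP := computable_denominator nP; computability.
Qed.

Lemma computable_search_bound k n :
  computable k n -> computable k (fun xs => search_bound (n xs)).
Proof.
move=> nP; apply: computable_succ; have maxP := computable_coefficient_max nP.
apply: (computable_iteri (g := fun _ u xs => 2 ^ coefficient_max (n xs) * u.*2.+1)) => //.
  exact: computable_const.
apply: computable_mul; last by computability.
by apply: computable_expn; [computability | apply: (computable_weaken2 maxP)].
Qed.

Lemma decidable_is_solution k inp c y i :
    reads k inp -> computable k c -> computable k y -> computable k i ->
  decidable_pred k (fun xs => is_solution (inp xs) (c xs) (y xs) (i xs)).
Proof.
move=> inpP cP yP iP.
have DP := computable_denominator (computable_nsites inpP).
have ciP := computable_entry cP iP.
apply: decidable_eq; repeat apply: computable_add.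
- by apply: computable_mul; [apply: computable_degree_at | computability].
- by apply: (computable_neighbour_sum _ (v := fun j xs => entry (y xs) j)) => //; computability.
- by apply: computable_mul => //; apply: computable_neg_part.
- by apply: (computable_neighbour_sum _ (v := fun j xs => entry (y xs) j)) => //; computability.
- by apply: computable_mul => //; apply: computable_pos_part.
Qed.

Lemma decidable_represents k inp c y :
    reads k inp -> computable k c -> computable k y ->
  decidable_pred k (fun xs => represents (inp xs) (c xs) (y xs)).
Proof.
move=> inpP cP yP.
apply: (decidable_all (P := fun i xs => is_solution (inp xs) (c xs) (y xs) i &&
  (total_neighbour_sum (inp xs) (entry (y xs)) i <= degree_at (inp xs) i * entry (y xs) i))).
  by computability.
apply: decidable_and; first by apply: decidable_is_solution; computability.
apply: decidable_leq.
  apply: (computable_total_neighbour_sum (v := fun j xs => entry (y (behead xs)) j)); computability.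
by apply: computable_mul; [apply: computable_degree_at | ]; computability.
Qed.

Lemma computable_chips_at k inp y i :
    reads k inp -> computable k y -> computable k i ->
  computable k (fun xs => chips_at (inp xs) (y xs) (i xs)).
Proof.
move=> inpP yP iP; apply: computable_sub.
  by apply: computable_mul; [apply: computable_degree_at | computability].
by apply: (computable_total_neighbour_sum (v := fun j xs => entry (y xs) j)) => //; computability.
Qed.

Lemma computable_inner_degree_at k inp t i :
    reads k inp -> computable k t -> computable k i ->
  computable k (fun xs => inner_degree_at (inp xs) (t xs) (i xs)).
Proof.
move=> inpP tP iP.
apply: (computable_total_neighbour_sum (v := fun j xs => entry (t xs) j != 0)) => //.
by computability.
Qed.

Lemma decidable_every_subset k inp (R : nat -> nat -> seq nat -> bool) :
    reads k inp ->
    decidable_pred k.+2 (fun xs => R (nth 0 xs 1) (nth 0 xs 0) (behead (behead xs))) ->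
  decidable_pred k (fun xs => every_subset (inp xs) (fun t i => R t i xs)).
Proof.
move=> inpP RP.
apply: (decidable_all (P := fun t xs =>
   has (fun i => entry t i != 0) (iota 0 (nsites (inp xs))) ==>
   has (fun i => (entry t i != 0) && R t i xs) (iota 0 (nsites (inp xs))))).
  exact/computable_search_bound/computable_nsites.
apply: decidable_implies.
  apply: (decidable_has (P := fun i xs => entry (nth 0 xs 0) i != 0)); computability.
apply: (decidable_has (P := fun i xs =>
  (entry (nth 0 xs 0) i != 0) && R (nth 0 xs 0) i (behead xs))).
  by computability.
apply: decidable_and; first by computability.
by apply: computable_ext RP => -[|x [|y xs]].
Qed.

Lemma decidable_superstable_test k inp c :
    reads k inp -> computable k c ->
  decidable_pred k (fun xs => superstable_test (inp xs) (c xs)).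
Proof.
move=> inpP cP; have nP := computable_nsites inpP.
apply: decidable_and; first exact: decidable_size.
apply: (decidable_has (P := fun y xs => represents (inp xs) (c xs) y &&
   every_subset (inp xs) (fun t i =>
     chips_at (inp xs) y i + denominator (nsites (inp xs)) * inner_degree_at (inp xs) t i
       < denominator (nsites (inp xs)) * degree_at (inp xs) i))).
  exact: computable_search_bound.
apply: decidable_and; first by apply: decidable_represents; computability.
apply: (decidable_every_subset (inp := fun xs => inp (behead xs)) (R := fun t i xs =>
   chips_at (inp (behead xs)) (nth 0 xs 0) i
     + denominator (nsites (inp (behead xs))) * inner_degree_at (inp (behead xs)) t i
   < denominator (nsites (inp (behead xs))) * degree_at (inp (behead xs)) i)).
  by computability.
have inp3P := reads_weaken (reads_weaken (reads_weaken inpP)).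
have DP := computable_denominator (computable_nsites inp3P).
apply: decidable_ltn; [apply: computable_add; last apply: computable_mul => //|].
- by apply: computable_chips_at; computability.
- by apply: computable_inner_degree_at; computability.
- by apply: computable_mul => //; apply: computable_degree_at; computability.
Qed.

Lemma decidable_critical_test k inp c :
    reads k inp -> computable k c ->
  decidable_pred k (fun xs => critical_test (inp xs) (c xs)).
Proof.
move=> inpP cP; have nP := computable_nsites inpP.
apply: decidable_and; first exact: decidable_size.
apply: (decidable_has (P := fun y xs =>
   [&& represents (inp xs) (c xs) y, below_degree (inp xs) y &
       every_subset (inp xs) (fun t i =>
         denominator (nsites (inp xs)) * inner_degree_at (inp xs) t i
           <= chips_at (inp xs) y i)])).
  exact: computable_search_bound.
apply: decidable_and; first by apply: decidable_represents; computability.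
apply: decidable_and.
  apply: (decidable_all (P := fun i xs => chips_at (inp (behead xs)) (nth 0 xs 0) i
     < denominator (nsites (inp (behead xs))) * degree_at (inp (behead xs)) i)).
    by computability.
  have inp2P := reads_weaken (reads_weaken inpP).
  have DP := computable_denominator (computable_nsites inp2P).
  apply: decidable_ltn; first by apply: computable_chips_at; computability.
  by apply: computable_mul => //; apply: computable_degree_at; computability.
apply: (decidable_every_subset (inp := fun xs => inp (behead xs)) (R := fun t i xs =>
   denominator (nsites (inp (behead xs))) * inner_degree_at (inp (behead xs)) t i
     <= chips_at (inp (behead xs)) (nth 0 xs 0) i)).
  by computability.
have inp3P := reads_weaken (reads_weaken (reads_weaken inpP)).
have DP := computable_denominator (computable_nsites inp3P).
apply: decidable_leq; first apply: computable_mul => //.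
- by apply: computable_inner_degree_at; computability.
- by apply: computable_chips_at; computability.
Qed.

Definition test_output g :=
  code [:: code (listing (search_bound (nsites g)) (superstable_test g));
           code (listing (search_bound (nsites g)) (critical_test g))].

Lemma computable_test_output : computable 3 test_output.
Proof.
have inpP : reads 3 id by move=> j; apply: computable_proj.
have KP : computable 3 (fun xs => search_bound (nsites xs)).
  exact/computable_search_bound/(computable_nsites inpP).
have eP : computable 4 (fun xs => nth 0 xs 0) by apply: computable_proj.
have inp1P := reads_weaken inpP.
have outP (P : nat -> seq nat -> bool) :
    decidable_pred 4 (fun xs => P (nth 0 xs 0) (behead xs)) ->
  computable 3 (fun xs => code (listing (search_bound (nsites xs)) (fun e => P e xs))).
  by move=> PP; apply: computable_listing.
pose cons_code a b := code (a :: decode b).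
apply: (@computable_ext 3 (fun xs =>
   cons_code (code (listing (search_bound (nsites xs)) (superstable_test xs)))
     (cons_code (code (listing (search_bound (nsites xs)) (critical_test xs))) 0))).
  by move=> xs; rewrite /cons_code CodeSeq.codeK.
apply: computable_code_cons; last apply: computable_code_cons.
- by apply: (outP (fun e xs => superstable_test xs e)); apply: decidable_superstable_test.
- by apply: (outP (fun e xs => critical_test xs e)); apply: decidable_critical_test.
- exact: computable_const.
Qed.

(** * Correctness of the procedure *)

Lemma leq_code_bound b s :
  all (fun x => x <= b) s -> code s <= code_bound b (size s).
Proof.
elim: s => //= x s IH /andP[le_xb /IH le_s].
by rewrite leq_mul ?leq_exp2l // ltnS leq_double.
Qed.

Lemma code_mkseq_bound b n (f : 'I_n -> nat) :
  (forall i, f i <= b) -> code [seq f i | i <- enum 'I_n] <= code_bound b n.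
Proof.
move=> f_le; have := @leq_code_bound b [seq f i | i <- enum 'I_n].
rewrite size_map size_enum_ord; apply.
by apply/allP => _ /mapP[i _ ->].
Qed.

Lemma entry_code_map n (f : 'I_n -> nat) (i : 'I_n) :
  entry (code [seq f j | j <- enum 'I_n]) i = f i.
Proof. by rewrite /entry CodeSeq.codeK (nth_map i) ?size_enum_ord // nth_ord_enum. Qed.

Lemma all_iota_ord n (P : pred nat) :
  reflect (forall i : 'I_n, P i) (all P (iota 0 n)).
Proof.
apply: (iffP allP) => [allP i|allP i]; first by apply: allP; rewrite mem_iota /=.
by rewrite mem_iota => lt_i; apply: (allP (Ordinal lt_i)).
Qed.

Lemma has_iota_ord n (P : pred nat) :
  reflect (exists i : 'I_n, P i) (has P (iota 0 n)).
Proof.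
apply: (iffP hasP) => [[i]|[i Pi]]; last by exists (i : nat); rewrite ?mem_iota /=.
by rewrite mem_iota => lt_i Pi; exists (Ordinal lt_i).
Qed.

Lemma nth_allpairs (S T : Type) (f : S -> T -> nat) x0 y0 (s : seq S) (t : seq T) i j :
    i < size s -> j < size t ->
  nth 0 [seq f x y | x <- s, y <- t] (i * size t + j) = f (nth x0 s i) (nth y0 t j).
Proof.
move=> lt_i lt_j; elim: s i lt_i => //= x s IH [_|i lt_i] /=; rewrite nth_cat size_map.
  by rewrite lt_j (nth_map y0).
by rewrite mulSn -addnA ltnNge leq_addr addKn IH.
Qed.

Definition decode_int (e : nat) : int := (pos_part e)%:Z - (neg_part e)%:Z.

Lemma pos_part_double h : pos_part h.*2 = h.
Proof.
rewrite /pos_part; case: h => [|h]; first by rewrite big_geq.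
rewrite (bigD1_seq h.+1) ?iota_uniq //=; last by rewrite mem_index_iota /= -addnn; lia.
rewrite eqxx mul1n big1 ?addn0 // => h' ne_h.
by rewrite (inj_eq double_inj) (negPf ne_h).
Qed.

Lemma pos_part_doubleS h : pos_part h.*2.+1 = 0.
Proof. by rewrite /pos_part big1 // => h' _; case: eqP => // ?; lia. Qed.

Lemma neg_part_double h : neg_part h.*2 = 0.
Proof. by rewrite /neg_part big1 // => h' _; case: eqP => // ?; lia. Qed.

Lemma neg_part_doubleS h : neg_part h.*2.+1 = h.+1.
Proof.
rewrite /neg_part (bigD1_seq h) ?iota_uniq //=; last by rewrite mem_index_iota /= -addnn; lia.
rewrite eqxx mul1n big1 ?addn0 // => h' ne_h.
by rewrite eqSS (inj_eq double_inj) (negPf ne_h).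
Qed.

Lemma encode_intK : cancel encode_int decode_int.
Proof.
case=> m; rewrite /decode_int /encode_int.
  by rewrite pos_part_double neg_part_double GRing.subr0.
by rewrite pos_part_doubleS neg_part_doubleS GRing.sub0r NegzE.
Qed.

Lemma decode_intK : cancel decode_int encode_int.
Proof.
move=> e; rewrite -[e]odd_double_half; move: (e./2) => h; case: (odd e) => /=.
  by rewrite add1n /decode_int pos_part_doubleS neg_part_doubleS GRing.sub0r -NegzE.
by rewrite add0n /decode_int pos_part_double neg_part_double GRing.subr0.
Qed.

Lemma encode_int_le z m : (`|z| <= m%:Z)%R -> encode_int z <= m.*2.+1.
Proof. by case: z => k /=; lia. Qed.

Section Correctness.

Import Order.TTheory GRing.Theory Num.Theory.
Local Open Scope ring_scope.

Variables (n : nat) (G : signed_graph n) (q : 'I_n.+1).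

Local Notation L := (reduced_laplacian G q).
Local Notation M := (reduced_laplacian (all_positive G) q).
Local Notation adj i j := (edge G (lift q i) (lift q j)).
Local Notation pos i j := (positive G (lift q i) (lift q j)).
Local Notation deg i := (degree G (lift q i)).
Local Notation D := (denominator n).
Local Notation g := (encode_input G q).

Lemma Posz_sum (I : finType) (P : pred I) (F : I -> nat) :
  (\sum_(i | P i) F i)%N%:Z = \sum_(i | P i) (F i)%:Z.
Proof. by rewrite -natz natr_sum; apply: eq_bigr => i _; rewrite natz. Qed.

Lemma label_edge (u v : 'I_n.+1) : label g u v = edge_label G u v.
Proof.
rewrite /label /entry CodeSeq.codeK -[X in (_ * X + _)%N](size_enum_ord n.+1).
by rewrite (nth_allpairs _ u v) ?size_enum_ord // !nth_ord_enum.
Qed.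

Lemma label_lift (i j : 'I_n) :
  label g (site g i) (site g j) = edge_label G (lift q i) (lift q j).
Proof. exact: (label_edge (lift q i) (lift q j)). Qed.

Lemma degree_atE (i : 'I_n) : degree_at g i = deg i.
Proof.
rewrite /degree_at big_mkord /degree -sum1dep_card [RHS]big_mkcond; apply: eq_bigr => v _.
rewrite (label_edge (lift q i) v) /edge_label.
by case: ifP => // _; case: ifP.
Qed.

Lemma neighbour_sum_pos (v : nat -> nat) (i : 'I_n) :
  neighbour_sum 1 g v i = (\sum_(j | adj i j && pos i j) v j)%N.
Proof.
rewrite /neighbour_sum big_mkord [RHS]big_mkcond; apply: eq_bigr => j _.
by rewrite label_lift /edge_label; case: (adj i j); case: (pos i j); rewrite ?mul1n.
Qed.

Lemma neighbour_sum_neg (v : nat -> nat) (i : 'I_n) :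
  neighbour_sum 2 g v i = (\sum_(j | adj i j && ~~ pos i j) v j)%N.
Proof.
rewrite /neighbour_sum big_mkord [RHS]big_mkcond; apply: eq_bigr => j _.
by rewrite label_lift /edge_label; case: (adj i j); case: (pos i j); rewrite ?mul1n.
Qed.

Lemma total_neighbour_sumE (v : nat -> nat) (i : 'I_n) :
  total_neighbour_sum g v i = (\sum_(j | adj i j) v j)%N.
Proof.
rewrite /total_neighbour_sum neighbour_sum_pos neighbour_sum_neg.
by rewrite [RHS](bigID (fun j => pos i j)).
Qed.

Definition coded_set (t : nat) : {set 'I_n} := [set i : 'I_n | entry t i != 0%N].

Lemma inner_degree_atE t (i : 'I_n) : inner_degree_at g t i = inner_degree G q (coded_set t) i.
Proof.
rewrite /inner_degree_at total_neighbour_sumE /inner_degree.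
rewrite [LHS]big_mkcond [RHS]big_mkcond; apply: eq_bigr => j _.
by rewrite inE; case: (adj i j); case: (entry t j != 0)%N.
Qed.

Definition coded_vector (y : nat) : 'cV[int]_n := \col_i (entry y i)%:Z.

Definition decode_config (e : nat) : 'cV[int]_n := \col_i decode_int (entry e i).

Lemma encode_configK : cancel (@encode_config n) decode_config.
Proof.
by move=> c; apply/colP => i; rewrite mxE /encode_config entry_code_map encode_intK.
Qed.

Lemma decode_configK e : size (decode e) = n -> encode_config (decode_config e) = e.
Proof.
move=> sz; rewrite /encode_config -[RHS]CodeSeq.decodeK; congr code.
apply: (@eq_from_nth _ 0%N); rewrite size_map size_enum_ord // => i lt_i.
rewrite (nth_map (Ordinal lt_i)) ?size_enum_ord // mxE decode_intK.
by rewrite nth_enum_ord.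
Qed.

Lemma is_solutionE e y (i : 'I_n) :
  is_solution g e y i = ((L *m coded_vector y) i 0 == D%:Z * decode_config e i 0).
Proof.
have -> : (L *m coded_vector y) i 0 = (degree_at g i * entry y i)%N%:Z
    + (neighbour_sum 2 g (entry y) i)%:Z - (neighbour_sum 1 g (entry y) i)%:Z.
  have <- : map_mx intr L = L by apply/matrixP => j k; rewrite !mxE intz.
  rewrite reduced_laplacianE mxE degree_atE neighbour_sum_pos neighbour_sum_neg.
  by rewrite PoszM natz !Posz_sum; congr (_ + _ - _); apply: eq_bigr => j _; rewrite mxE.
rewrite mxE /decode_int /is_solution mulrBr -!PoszM.
move: (_ * _)%N (neighbour_sum 2 _ _ _) (D * _)%N (neighbour_sum 1 _ _ _) (D * _)%N.
by move=> a b c d e'; rewrite -eqz_nat; apply/eqP/eqP; lia.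
Qed.

Lemma laplacian_coded_vector y (i : 'I_n) :
  (M *m coded_vector y) i 0 =
    (degree_at g i * entry y i)%N%:Z - (total_neighbour_sum g (entry y) i)%:Z.
Proof.
rewrite laplacian_intE mxE degree_atE total_neighbour_sumE PoszM natz Posz_sum.
by congr (_ - _); apply: eq_bigr => j _; rewrite mxE.
Qed.

Lemma representsP e y :
  reflect (L *m coded_vector y = D%:Z *: decode_config e /\
           forall i : 'I_n, (chips_at g y i)%:Z = (M *m coded_vector y) i 0)
    (represents g e y).
Proof.
apply: (iffP (all_iota_ord _ _)) => [rep|[LY MY] i].
  split=> [|i]; last first.
    by have /andP[_ le_i] := rep i; rewrite laplacian_coded_vector /chips_at subzn.
  apply/colP => i; have /andP[sol _] := rep i; move: sol.
  by rewrite is_solutionE => /eqP ->; rewrite [RHS]mxE.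
rewrite is_solutionE LY mxE eqxx /= -lez_nat -subr_ge0 -laplacian_coded_vector.
by rewrite -MY.
Qed.

Lemma subset_code (T : {set 'I_n}) :
  exists2 t, (t < search_bound n)%N & coded_set t = T.
Proof.
exists (code [seq (i \in T : nat) | i <- enum 'I_n]).
  rewrite ltnS; apply: code_mkseq_bound => i.
  by apply: leq_trans (leq_b1 _) _; rewrite /coefficient_max ltnS.
by apply/setP => i; rewrite inE entry_code_map; case: (i \in T).
Qed.

Lemma every_subsetP (R : nat -> nat -> bool) (S : {set 'I_n} -> 'I_n -> Prop) :
    (forall t (i : 'I_n), reflect (S (coded_set t) i) (R t i)) ->
  reflect (forall T : {set 'I_n}, T != set0 -> exists2 i, i \in T & S T i)
    (every_subset g R).
Proof.
move=> RP; apply: (iffP allP) => [all_R T T_neq0|all_S t _].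
  have [t lt_t def_T] := subset_code T.
  have := all_R t; rewrite mem_iota /= => /(_ lt_t)/implyP R_t.
  have /R_t/has_iota_ord[i /andP[ti /RP]] : has (fun i => entry t i != 0%N) (iota 0 n).
    have [i iT] := set0Pn _ T_neq0; apply/has_iota_ord; exists i.
    by rewrite -def_T inE in iT.
  by rewrite def_T; exists i; rewrite // -def_T inE.
apply/implyP => /has_iota_ord[i0 ti0].
have [|i] := all_S (coded_set t); first by apply/set0Pn; exists i0; rewrite inE.
by rewrite inE => ti /RP Ri; apply/has_iota_ord; exists i; rewrite ti.
Qed.

Hypothesis G_connected : connected_graph G.

Lemma D_gt0 : 0 < D%:R :> rat.
Proof. by rewrite ltr0n denominator_gt0. Qed.

Lemma chips_at_chips e y (i : 'I_n) :
  represents g e y -> (chips_at g y i)%:R = D%:R * chips G q (decode_config e) i 0.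
Proof.
move=> /representsP[LY MY]; rewrite -(solution_chips G_connected LY) -MY.
by rewrite pmulrn.
Qed.

Lemma represents_valid e y :
  represents g e y -> forall i, 0 <= chips G q (decode_config e) i 0.
Proof. by move=> rep i; rewrite -(pmulr_rge0 _ D_gt0) -(chips_at_chips i rep). Qed.

(** Only configurations with fewer chips than degrees at every site need a coded
    potential within the search bound: superstable and critical ones are of this
    kind. *)
Lemma represents_exists e :
    (forall i, 0 <= chips G q (decode_config e) i 0 < (deg i)%:R) ->
  exists2 y, (y < search_bound n)%N & represents g e y.
Proof.
move=> e_stable; have [Y LY] := solution_exists q G_connected (decode_config e).
have Y_bounds := solution_bounds G_connected e_stable LY.
have Y_abs i : (absz (Y i 0))%:Z = Y i 0.
  by have /andP[Y_ge0 _] := Y_bounds i; rewrite gez0_abs.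
exists (code [seq absz (Y i 0%R) | i <- enum 'I_n]).
  rewrite ltnS; apply: code_mkseq_bound => i; rewrite -lez_nat Y_abs.
  have /andP[_ Y_le] := Y_bounds i; apply: le_trans Y_le _.
  rewrite lez_nat /coefficient_max; apply: leqW; rewrite -addnn; apply: leq_trans (leq_addr _ _).
  by rewrite leq_mul2l leq_pmull ?orbT.
have def_Y : coded_vector (code [seq absz (Y i 0%R) | i <- enum 'I_n]) = Y.
  by apply/colP => i; rewrite mxE entry_code_map Y_abs.
apply/representsP; rewrite def_Y; split=> // i.
have := laplacian_coded_vector (code [seq absz (Y i 0%R) | i <- enum 'I_n]) i.
rewrite def_Y => MY; rewrite MY subzn // -lez_nat -subr_ge0 -MY.
rewrite -(ler0z rat) (solution_chips G_connected LY) pmulr_rge0 ?D_gt0 //.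
by case/andP: (e_stable i).
Qed.

Lemma encode_bound c :
    (forall i, 0 <= chips G q c i 0 < (deg i)%:R) ->
  (encode_config c < search_bound n)%N.
Proof.
move=> /(stable_bounds G_connected) c_le; rewrite ltnS.
apply: code_mkseq_bound => i; apply: leq_trans (encode_int_le (c_le i)) _.
rewrite ltnS leq_double.
by rewrite -[leqLHS]mul1n leq_mul ?denominator_gt0 ?leq_mul.
Qed.

(** The condition on singletons. *)
Lemma superstable_below_degree c :
  z_superstable G q c -> forall i, 0 <= chips G q c i 0 < (deg i)%:R.
Proof.
move=> /(z_superstable_iff q G_connected)[c_ge0 stableT] i; rewrite c_ge0 /=.
have [|j] := stableT [set i]; first by apply/set0Pn; exists i; rewrite inE.
by rewrite inE => /eqP ->; rewrite /inner_degree big_set1 edge_irr subr0.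
Qed.

Lemma superstable_testP e :
  reflect (size (decode e) = n /\ z_superstable G q (decode_config e))
    (superstable_test g e).
Proof.
have subsetP y : represents g e y ->
  reflect (forall T : {set 'I_n}, T != set0 -> exists2 i, i \in T &
             chips G q (decode_config e) i 0 < (deg i)%:R - (inner_degree G q T i)%:R)
    (every_subset g (fun t i =>
       (chips_at g y i + D * inner_degree_at g t i < D * degree_at g i)%N)).
  move=> rep; apply: every_subsetP => t i; apply: (equivP idP).
  rewrite -(ltr_nat rat) natrD !natrM degree_atE inner_degree_atE (chips_at_chips i rep).
  by rewrite -mulrDr ltr_pM2l ?D_gt0 // ltrBrDr.
apply: (iffP andP) => [[/eqP sz /hasP[y _ /andP[rep /(subsetP y rep) stableT]]]|].
  split=> //; apply/z_superstable_iff => //; split=> //; exact: represents_valid rep.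
move=> [sz /(z_superstable_iff q G_connected)[c_ge0 stableT]]; split; first exact/eqP.
have [|y lt_y rep] := represents_exists (e := e).
  by apply: superstable_below_degree; apply/z_superstable_iff.
apply/hasP; exists y; first by rewrite mem_iota.
by rewrite rep; apply/(subsetP y rep).
Qed.

Lemma critical_testP e :
  reflect (size (decode e) = n /\ critical G q (decode_config e))
    (critical_test g e).
Proof.
have subsetP y : represents g e y ->
  reflect (forall T : {set 'I_n}, T != set0 -> exists2 i, i \in T &
             (inner_degree G q T i)%:R <= chips G q (decode_config e) i 0)
    (every_subset g (fun t i => (D * inner_degree_at g t i <= chips_at g y i)%N)).
  move=> rep; apply: every_subsetP => t i; apply: (equivP idP).
  rewrite -(ler_nat rat) natrM inner_degree_atE (chips_at_chips i rep).
  by rewrite ler_pM2l ?D_gt0.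
have belowP y : represents g e y ->
  reflect (forall i, 0 <= chips G q (decode_config e) i 0 < (deg i)%:R) (below_degree g y).
  move=> rep; apply: (equivP (all_iota_ord _ _)).
  have lt_iff (i : 'I_n) : (chips_at g y i < D * degree_at g i)%N
      = (0 <= chips G q (decode_config e) i 0 < (deg i)%:R).
    rewrite -(ltr_nat rat) natrM degree_atE (chips_at_chips i rep) ltr_pM2l ?D_gt0 //.
    by rewrite (represents_valid rep).
  by split=> below i; have := below i; rewrite lt_iff.
apply: (iffP andP) => [[/eqP sz /hasP[y _ /and3P[rep below rec]]]|].
  split=> //; apply/critical_iff => //.
  by split; [apply/(belowP y rep) | apply/(subsetP y rep)].
move=> [sz /(critical_iff q G_connected)[c_stable c_rec]]; split; first exact/eqP.
have [y lt_y rep] := represents_exists c_stable.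
apply/hasP; exists y; first by rewrite mem_iota.
by apply/and3P; split=> //; [apply/(belowP y rep) | apply/(subsetP y rep)].
Qed.

(** Coding is a bijection between configurations and codes of sequences of length
    [n], so distinct codes give distinct configurations. *)
Lemma listing_lists (P : pred nat) (Q : 'cV[int]_n -> Prop) :
    (forall e, reflect (size (decode e) = n /\ Q (decode_config e)) (P e)) ->
    (forall c, Q c -> (encode_config c < search_bound n)%N) ->
  exists s, lists_exactly s Q /\ encode_configs s = code (listing (search_bound n) P).
Proof.
move=> PP Q_bound; pose l := listing (search_bound n) P.
have encode_l : map (@encode_config n) (map decode_config l) = l.
  rewrite -map_comp map_id_in // => e; rewrite mem_listing => /andP[_ /PP[sz _]].
  exact: decode_configK.
exists (map decode_config l); split; last by rewrite /encode_configs encode_l.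
split; first by apply: (@map_uniq _ _ (@encode_config n)); rewrite encode_l uniq_listing.
move=> c; split=> [/mapP[e]|Qc].
  by rewrite mem_listing => /andP[_ /PP[_ Qe]] ->.
apply/mapP; exists (encode_config c); last by rewrite encode_configK.
rewrite mem_listing Q_bound //=; apply/PP; rewrite encode_configK; split=> //.
by rewrite /encode_config CodeSeq.codeK size_map size_enum_ord.
Qed.

End Correctness.

Theorem proposition3p7 :
  exists p : program,
    forall (n : nat) (G : signed_graph n) (q : 'I_n.+1),
      connected_graph G ->
      exists superstables criticals : seq 'cV[int]_n,
        [/\ runs p (encode_input G q) (encode_output superstables criticals),
            lists_exactly superstables (z_superstable G q)
          & lists_exactly criticals (critical G q)].
Proof.
have [p pP] := computable_test_output; exists p => n G q G_connected.
have [s [s_lists s_code]] := listing_lists (superstable_testP q G_connected)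
  (fun c => fun Qc => encode_bound G_connected (superstable_below_degree G_connected Qc)).
have [t [t_lists t_code]] := listing_lists (critical_testP q G_connected)
  (fun c Qc => encode_bound G_connected (proj1 (proj1 (critical_iff q G_connected c) Qc))).
exists s, t; split=> //.
by rewrite /encode_output s_code t_code; apply: pP.
Qed.
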